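(* Let $\mathbb{F}_q$ be a finite field with $q$ elements. (1) If $q>4$, every smooth plane cubic over $\mathbb{F}_q$ admits a linear determinantal representation over $\mathbb{F}_q$. (2) If $q\le 4$ (i.e. $q\in\{2,3,4\}$), there is exactly one projective equivalence class of smooth plane cubics over $\mathbb{F}_q$ admitting no linear determinantal representation over $\mathbb{F}_q$; a representative is given by $X^2Z+XZ^2+Y^3+Y^2Z+Z^3=0$ for $q=2$, by $X^2Z+Y^3-YZ^2+Z^3=0$ for $q=3$, and by $X^2Z+XZ^2+Y^3+\omega Z^3=0$ for $q=4$.
   Context: A smooth plane cubic $C\subset\mathbb{P}^2$ over $\mathbb{F}_q$ is defined by a ternary cubic form $F$ over $\mathbb{F}_q$. A linear determinantal representation of $C$ over $\mathbb{F}_q$ is a $3\times3$ matrix $M$ of $\mathbb{F}_q$-linear forms in $X,Y,Z$ with $F=\lambda\det(M)$ for some $\lambda\in\mathbb{F}_q^\times$. Two smooth plane cubics $C,C'$ over $\mathbb{F}_q$ are projectively equivalent if there is an automorphism of $\mathbb{P}^2$ over $\mathbb{F}_q$ inducing an isomorphism $C\cong C'$. $\omega\in\mathbb{F}_4$ denotes an element with $\omega^2+\omega+1=0$. *)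

(* Defs.v *)
From HB Require Import structures.
From mathcomp Require Import all_boot all_order all_algebra all_field.
From mathcomp Require Export mpoly.
Set Implicit Arguments. Unset Strict Implicit. Unset Printing Implicit Defensive.
Import GRing.Theory.
Local Open Scope ring_scope.

Section Cubics.
Variable F : fieldType.

Definition cX : {mpoly F[3]} := 'X_(@Ordinal 3 0 isT).
Definition cY : {mpoly F[3]} := 'X_(@Ordinal 3 1 isT).
Definition cZ : {mpoly F[3]} := 'X_(@Ordinal 3 2 isT).

Definition cubic_form (P : {mpoly F[3]}) : Prop := P != 0 /\ P \is 3.-homog.

Definition singular_at (L : fieldType) (f : {rmorphism F -> L})
  (P : {mpoly F[3]}) (v : 'I_3 -> L) : Prop :=
  (map_mpoly f P).@[v] = 0 /\ forall i : 'I_3, (mderiv i (map_mpoly f P)).@[v] = 0.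

(* Smooth plane cubic: a cubic form whose curve has no singular point over
   any extension field of F (equivalently over the algebraic closure). *)
Definition smooth_cubic (P : {mpoly F[3]}) : Prop :=
  cubic_form P /\
  forall (L : fieldType) (f : {rmorphism F -> L}) (v : 'I_3 -> L),
    (exists i, v i != 0) -> ~ singular_at f P v.

Definition has_ldr (P : {mpoly F[3]}) : Prop :=
  exists (M : 'M[{mpoly F[3]}]_3) (lam : F),
    lam != 0 /\ (forall i j, M i j \is 1.-homog) /\ P = lam *: \det M.

Definition lin_subst (A : 'M[F]_3) : 3.-tuple {mpoly F[3]} :=
  [tuple (\sum_(j < 3) A i j *: 'X_j) | i < 3].

Definition proj_equiv (P Q : {mpoly F[3]}) : Prop :=
  exists (A : 'M[F]_3) (c : F),
    A \in unitmx /\ c != 0 /\ comp_mpoly (lin_subst A) P = c *: Q.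

Definition unique_nonldr_class (G : {mpoly F[3]}) : Prop :=
  smooth_cubic G /\ ~ has_ldr G /\
  forall P, smooth_cubic P -> ~ has_ldr P -> proj_equiv P G.

Definition cubic_q2 : {mpoly F[3]} :=
  cX ^+ 2 * cZ + cX * cZ ^+ 2 + cY ^+ 3 + cY ^+ 2 * cZ + cZ ^+ 3.
Definition cubic_q3 : {mpoly F[3]} :=
  cX ^+ 2 * cZ + cY ^+ 3 - cY * cZ ^+ 2 + cZ ^+ 3.
Definition cubic_q4 (w : F) : {mpoly F[3]} :=
  cX ^+ 2 * cZ + cX * cZ ^+ 2 + cY ^+ 3 + w *: cZ ^+ 3.

End Cubics.

(* Main.v *)
Require Import Defs.
From HB Require Import structures.
From mathcomp Require Import all_boot all_order all_algebra all_field.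
From mathcomp Require Import mpoly.
From mathcomp Require Import ring zify.
Import GRing.Theory.
Local Open Scope ring_scope.

Set Implicit Arguments.
Unset Strict Implicit.
Unset Printing Implicit Defensive.

(** A cubic with two distinct rational points [a], [b] has a representation: swapping
    them if needed, the tangent line at [a] avoids [b], so in suitable coordinates the
    monomials X^3, Y^3 and X^2 Z are absent, and then the cubic lies in the ideal
    (XY, YZ, Z^2) of 2x2 minors of [[Y, Z, 0], [0, X, Z]].  A smooth cubic with exactly
    one rational point has a flex there and thus a Weierstrass equation
    with no affine solution.  For q > 4 this contradicts a count of double roots in the
    manner of Stepanov: with f the discriminant in x (q odd) one uses
    f' (x^q - x) + 2 f (f^((q-1)/2) + 1), and for q even
    Tr(p) + 1 + p' (x^q - x).  For q <= 4 the equations are normalised by hand.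
    Conversely a representation of a Weierstrass cubic produces an affine point by
    linear algebra, so the three exceptional cubics have none.

    A smooth cubic P always has a rational point.  Otherwise each rational line l meets
    P in three conjugate points.  Write a = (X, Y, Z), b = a^q, c = a^(q^2), let phi be
    the third intersection point of the line ab with P, and let G be the value at c of
    the tangent line at phi, a form of degree q^2 + 4 q + 4.  On the points of a
    rational line phi = c, so G vanishes doubly there; as
    q^2 + 4 q + 4 < 2 (q^2 + q + 1) for q > 2, P divides G.  By Bezout some point a of P
    over the closure has b on its tangent line; then phi = a, and G(a) = 0 puts c on that
    tangent line as well, which forces a rational point.  For q = 2 the eight forms
    without zeros are listed. *)

(** The bound 4 is that of Hasse and Weil: q + 1 - 2 sqrt(q) > 1 exactly when q > 4. Over a finite
    field a representation amounts to a non-trivial rational point of the Jacobian, so the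
    exceptional cubics are those with a single rational point. Both classical inputs, the Hasse-Weil
    bound and Lang's theorem that a rational point exists, are replaced here by polynomials with too
    many double zeros. Multiplicity two is essential: simple zeros would give only q, respectively
    q^2 + q + 1, conditions, fewer than the degrees 3 (q + 1) / 2, 3 q / 2 and q^2 + 4 q + 4 in
    play. Characteristics 2 and 3 cannot be set aside, since the exceptional cubics live there.
    Cubics are therefore handled through their ten coefficients, and tangency through coefficients
    of the expansion at s a + t b, never through a symmetric polar form. The closing contradiction:
    on the tangent line at a, which meets the cubic twice at a and once at b, the point c must be a
    or b. If c = b, then a = b already; if c = a, then the tangent at b contains a as well, and the
    line would lie in the cubic. *)

Local Notation o0 := (@Ordinal 3 0 isT).
Local Notation o1 := (@Ordinal 3 1 isT).
Local Notation o2 := (@Ordinal 3 2 isT).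

(** * Cubic forms in three variables *)

Lemma big_ord3 (R : Type) (idx : R) (op : Monoid.law idx) (f : 'I_3 -> R) :
  \big[op/idx]_(i < 3) f i = op (f o0) (op (f o1) (f o2)).
Proof.
rewrite !big_ord_recl big_ord0 Monoid.mulm1.
by congr (op (f _) (op (f _) (f _))); apply: val_inj.
Qed.

Lemma ord3P (Q : 'I_3 -> Prop) : Q o0 -> Q o1 -> Q o2 -> forall i, Q i.
Proof.
move=> H0 H1 H2 [[|[|[|i]]] Hi] //.
- by rewrite (_ : Ordinal Hi = o0) //; apply: val_inj.
- by rewrite (_ : Ordinal Hi = o1) //; apply: val_inj.
- by rewrite (_ : Ordinal Hi = o2) //; apply: val_inj.
Qed.

Section CubicExpressions.
Variable R : comNzRingType.
Implicit Types (k : nat -> R) (a b c : 'I_3 -> R) (s t u : R).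

Definition vec3 s t u : 'I_3 -> R := fun i => nth 0 [:: s; t; u] i.

(** The indices 0 to 9 of [k] number the monomials X^3, X^2 Y, X^2 Z, X Y^2, X Y Z, X Z^2, Y^3, Y^2
    Z, Y Z^2, Z^3; all coefficient lists below use this order. *)
Definition cub k a : R :=
  k 0%N * a o0 ^+ 3 + k 1%N * a o0 ^+ 2 * a o1 + k 2 * a o0 ^+ 2 * a o2
  + k 3 * a o0 * a o1 ^+ 2 + k 4 * a o0 * a o1 * a o2
  + k 5 * a o0 * a o2 ^+ 2 + k 6 * a o1 ^+ 3 + k 7 * a o1 ^+ 2 * a o2
  + k 8 * a o1 * a o2 ^+ 2 + k 9 * a o2 ^+ 3.

Definition grad k a : 'I_3 -> R := vec3
  (k 0%N * a o0 ^+ 2 *+ 3 + k 1%N * a o0 * a o1 *+ 2 + k 2 * a o0 * a o2 *+ 2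
   + k 3 * a o1 ^+ 2 + k 4 * a o1 * a o2 + k 5 * a o2 ^+ 2)
  (k 1%N * a o0 ^+ 2 + k 3 * a o0 * a o1 *+ 2 + k 4 * a o0 * a o2
   + k 6 * a o1 ^+ 2 *+ 3 + k 7 * a o1 * a o2 *+ 2 + k 8 * a o2 ^+ 2)
  (k 2 * a o0 ^+ 2 + k 4 * a o0 * a o1 + k 5 * a o0 * a o2 *+ 2
   + k 7 * a o1 ^+ 2 + k 8 * a o1 * a o2 *+ 2 + k 9 * a o2 ^+ 2 *+ 3).

Definition dot a b : R := a o0 * b o0 + a o1 * b o1 + a o2 * b o2.

(** This is the coefficient of s^2 t in the cubic at s a + t b; at a smooth point [a] its vanishing
    says that [b] lies on the tangent line. No division by 2 or 3 is involved. Likewise [tri] is the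
    coefficient of s t u. *)
Definition pol k a b : R := dot (grad k a) b.

Definition tri k a b c : R :=
  pol k (fun i => a i + b i) c - pol k a c - pol k b c.

Definition cross a b : 'I_3 -> R := vec3
  (a o1 * b o2 - a o2 * b o1) (a o2 * b o0 - a o0 * b o2)
  (a o0 * b o1 - a o1 * b o0).

Definition det3 a b c : R := dot (cross a b) c.

Lemma cub_comb k a b s t :
  cub k (fun i => s * a i + t * b i) =
  s ^+ 3 * cub k a + s ^+ 2 * t * pol k a b + s * t ^+ 2 * pol k b a
  + t ^+ 3 * cub k b.
Proof. by rewrite /cub /pol /grad /dot /vec3 /=; ring. Qed.

Lemma cub_comb3 k a b c s t u :
  cub k (fun i => s * a i + t * b i + u * c i) =
  s ^+ 3 * cub k a + s ^+ 2 * t * pol k a b + s ^+ 2 * u * pol k a c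
  + s * t ^+ 2 * pol k b a + s * t * u * tri k a b c
  + s * u ^+ 2 * pol k c a + t ^+ 3 * cub k b + t ^+ 2 * u * pol k b c
  + t * u ^+ 2 * pol k c b + u ^+ 3 * cub k c.
Proof. by rewrite /cub /tri /pol /grad /dot /vec3 /=; ring. Qed.

Lemma cubZ k a s : cub k (fun i => s * a i) = s ^+ 3 * cub k a.
Proof. by rewrite /cub; ring. Qed.

Lemma pol_diag k a : pol k a a = cub k a *+ 3.
Proof. by rewrite /cub /pol /grad /dot /vec3 /=; ring. Qed.

Lemma pol_comb k a b c s t :
  pol k a (fun i => s * b i + t * c i) = s * pol k a b + t * pol k a c.
Proof. by rewrite /pol /dot; ring. Qed.

Lemma polZl k a b s : pol k (fun i => s * a i) b = s ^+ 2 * pol k a b.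
Proof. by rewrite /pol /grad /dot /vec3 /=; ring. Qed.

Lemma polZr k a b s : pol k a (fun i => s * b i) = s * pol k a b.
Proof. by rewrite /pol /dot; ring. Qed.

Lemma pol_combl k a b c s t :
  pol k (fun i => s * a i + t * b i) c =
  s ^+ 2 * pol k a c + s * t * tri k a b c + t ^+ 2 * pol k b c.
Proof. by rewrite /tri /pol /grad /dot /vec3 /=; ring. Qed.

Lemma tri_diag13 k a b : tri k a b a = pol k a b *+ 2.
Proof. by rewrite /tri /pol /grad /dot /vec3 /=; ring. Qed.

Lemma tri_diag23 k a b : tri k a b b = pol k b a *+ 2.
Proof. by rewrite /tri /pol /grad /dot /vec3 /=; ring. Qed.

End CubicExpressions.

Lemma eq_cub (R : comNzRingType) (k k' : nat -> R) (a a' : 'I_3 -> R) :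
  k =1 k' -> a =1 a' -> cub k a = cub k' a'.
Proof. by move=> ek ea; rewrite /cub !ek !ea. Qed.

Lemma eq_pol (R : comNzRingType) (k k' : nat -> R) (a a' b b' : 'I_3 -> R) :
  k =1 k' -> a =1 a' -> b =1 b' -> pol k a b = pol k' a' b'.
Proof. by move=> ek ea eb; rewrite /pol /grad /dot /vec3 /= !ek !ea !eb. Qed.

Section Morphisms.
Variables (R S : comNzRingType) (f : {rmorphism R -> S}).

Lemma rmorph_cub k a : f (cub k a) = cub (f \o k) (f \o a).
Proof. by rewrite /cub /=; ring. Qed.

Lemma rmorph_grad k a i : f (grad k a i) = grad (f \o k) (f \o a) i.
Proof. by move: i; apply: ord3P; rewrite /grad /vec3 /=; ring. Qed.

Lemma rmorph_pol k a b : f (pol k a b) = pol (f \o k) (f \o a) (f \o b).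
Proof. by rewrite /pol /dot !rmorphD !rmorphM !rmorph_grad. Qed.

Lemma rmorph_tri k a b c :
  f (tri k a b c) = tri (f \o k) (f \o a) (f \o b) (f \o c).
Proof.
rewrite /tri !rmorphB !rmorph_pol; congr (_ - _ - _).
by apply: eq_pol => // i /=; rewrite rmorphD.
Qed.

End Morphisms.

Section Mpoly.
Variable F : fieldType.

Definition Xv : 'I_3 -> {mpoly F[3]} := fun i => 'X_i.
Definition kC (k : nat -> F) : nat -> {mpoly F[3]} := fun n => (k n)%:MP.
Definition cubm k := cub (kC k) Xv.

Lemma dhomog3_cubm (P : {mpoly F[3]}) : P \is 3.-homog -> exists k, P = cubm k.
Proof.
move=> /dhomogP hP; rewrite [P]mpolyE.
have: forall m, m \in msupp P -> mdeg m = 3 by [].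
elim: (msupp P : seq _) => [|m s IHs] hs.
  exists (fun=> 0); rewrite big_nil /cubm /cub /kC !mpolyC0; ring.
have [|k' Ek] := IHs; first by move=> m' hm'; apply: hs; rewrite inE hm' orbT.
rewrite big_cons Ek; have := hs m; rewrite inE eqxx => /(_ isT).
rewrite mdegE big_ord3 /= => hm.
rewrite mpolyXE_id big_ord3 /= -mul_mpolyC; set c := P@_m.
have K (j : nat) : cubm k' + c%:MP *
   cub (fun i => (i == j)%:R) Xv = cubm (fun i => k' i + c * (i == j)%:R).
  rewrite /cubm /cub /kC !rmorphD !rmorphM !rmorph_nat; ring.
suff [j ->] : exists j : nat, 'X_o0 ^+ m o0 * ('X_o1 ^+ m o1 * 'X_o2 ^+ m o2) =
    cub (fun i : nat => (i == j)%:R) Xv.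
  by eexists; rewrite addrC K.
move: (m o0) (m o1) (m o2) hm => [|[|[|[|i]]]] [|[|[|[|j]]]] [|[|[|[|l]]]] //= _.
- by exists 9; rewrite /cub /= /Xv; ring.
- by exists 8; rewrite /cub /= /Xv; ring.
- by exists 7; rewrite /cub /= /Xv; ring.
- by exists 6; rewrite /cub /= /Xv; ring.
- by exists 5; rewrite /cub /= /Xv; ring.
- by exists 4; rewrite /cub /= /Xv; ring.
- by exists 3; rewrite /cub /= /Xv; ring.
- by exists 2; rewrite /cub /= /Xv; ring.
- by exists 1%N; rewrite /cub /= /Xv; ring.
- by exists 0%N; rewrite /cub /= /Xv; ring.
Qed.

End Mpoly.

Lemma det_mx33 (R : comNzRingType) (M : 'M[R]_3) :
  \det M = det3 (fun i => M i o0) (fun i => M i o1) (fun i => M i o2).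
Proof.
have [g ->] : exists g : nat -> nat -> R, M = \matrix_(i, j) g i j.
  by exists (fun i j => M (inord i) (inord j)); apply/matrixP=> i j;
    rewrite !mxE !inord_val.
rewrite (expand_det_row _ ord0) !big_ord_recl big_ord0 /cofactor.
do 3!rewrite (expand_det_row _ ord0) !big_ord_recl big_ord0 /cofactor !det_mx11.
rewrite /det3 /cross /dot /vec3 /= !mxE /= /bump /= !(addn0, add0n, add1n).
ring.
Qed.

Section Substitution.
Variable F : fieldType.
Implicit Types (k : nat -> F) (A B M : 'M[F]_3) (P Q : {mpoly F[3]}).

Lemma lin_substE A (i : 'I_3) : (lin_subst A)`_i = \sum_(j < 3) A i j *: 'X_j.
Proof. by rewrite -tnth_nth tnth_map tnth_ord_tuple. Qed.

Lemma lin_subst_comp P A B :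
  (P \mPo lin_subst A) \mPo lin_subst B = P \mPo lin_subst (A *m B).
Proof.
rewrite [P \mPo lin_subst A]comp_mpolyEX [RHS]comp_mpolyEX raddf_sum /=.
apply: eq_bigr => m _; rewrite comp_mpolyZ; congr (_ *: _).
rewrite !comp_mpolyX rmorph_prod; apply: eq_bigr => i _.
rewrite rmorphXn /=; congr (_ ^+ _).
rewrite !(tnth_nth 0) !lin_substE raddf_sum /=.
under eq_bigr => j _ do rewrite comp_mpolyZ comp_mpolyXU lin_substE scaler_sumr.
rewrite exchange_big /=; apply: eq_bigr => j _; rewrite mxE scaler_suml.
by apply: eq_bigr => l _; rewrite scalerA.
Qed.

Lemma lin_subst1 P : P \mPo lin_subst 1%:M = P.
Proof.
rewrite -[RHS]comp_mpoly_id; congr (_ \mPo _); apply: eq_from_tnth => i.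
rewrite !tnth_map !tnth_ord_tuple (bigD1 i) //= mxE eqxx scale1r big1 ?addr0 //.
by move=> j ji; rewrite mxE eq_sym (negPf ji) scale0r.
Qed.

Lemma lin_subst_homog P A d : P \is d.-homog -> P \mPo lin_subst A \is d.-homog.
Proof.
move=> /dhomogP hP; rewrite comp_mpolyE big_seq rpred_sum // => m /hP /= Ed.
rewrite -Ed mdegE dhomogZ //.
elim/big_rec2: _ => [|i n Q _ hQ]; first exact: dhomog1.
apply: dhomogM => //; rewrite -[X in X.-homog]mul1n; apply: dhomogMn.
rewrite (tnth_nth 0) lin_substE rpred_sum // => j _.
by apply: dhomogZ; rewrite dhomogX; apply/eqP; apply: mdeg1.
Qed.

Lemma has_ldr_subst P A :
  A \in unitmx -> has_ldr (P \mPo lin_subst A) -> has_ldr P.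
Proof.
move=> uA [M [l [l0 [hM E]]]].
exists (map_mx (comp_mpoly (lin_subst (invmx A))) M), l; split=> //; split.
  by move=> i j; rewrite mxE; apply: lin_subst_homog.
by rewrite det_map_mx -comp_mpolyZ -E lin_subst_comp mulmxV // lin_subst1.
Qed.

Lemma proj_equiv_trans P Q S : proj_equiv P Q -> proj_equiv Q S -> proj_equiv P S.
Proof.
move=> [A [a [uA [a0 EA]]]] [B [b [uB [b0 EB]]]].
exists (A *m B), (a * b); split; first by rewrite unitmx_mul uA.
split; first by rewrite mulf_neq0.
by rewrite -lin_subst_comp EA comp_mpolyZ EB scalerA.
Qed.

Definition subst_coef k (a b c : 'I_3 -> F) : nat -> F :=
  nth 0 [:: cub k a; pol k a b; pol k a c; pol k b a; tri k a b c; pol k c a;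
            cub k b; pol k b c; pol k c b; cub k c].

Lemma comp_cubm k A :
  cubm k \mPo lin_subst A =
  cubm (subst_coef k (fun i => A i o0) (fun i => A i o1) (fun i => A i o2)).
Proof.
set a := fun i => A i o0; set b := fun i => A i o1; set c := fun i => A i o2.
rewrite {1}/cubm (rmorph_cub (comp_mpoly (lin_subst A))).
pose C (v : 'I_3 -> F) : 'I_3 -> {mpoly F[3]} := fun i => (v i)%:MP.
have -> : cub (comp_mpoly (lin_subst A) \o kC k) (comp_mpoly (lin_subst A) \o @Xv F)
   = cub (kC k) (fun i => 'X_o0 * C a i + 'X_o1 * C b i + 'X_o2 * C c i).
  apply: eq_cub => [n|i] /=; first by rewrite comp_mpolyC.
  rewrite comp_mpolyXU lin_substE big_ord3 /= -!mul_mpolyC /C /a /b /c; ring.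
rewrite cub_comb3.
pose m := @mpolyC 3 F.
rewrite -!(rmorph_cub m) -!(rmorph_pol m) -(rmorph_tri m).
by rewrite /cubm [RHS]/cub /kC /subst_coef /= /Xv; ring.
Qed.

Lemma meval_cubm k v : (cubm k).@[v] = cub k v.
Proof.
rewrite /cubm (rmorph_cub (meval v)); apply: eq_cub => [n|i] /=.
  exact: mevalC.
exact: mevalXU.
Qed.

Lemma mderiv_var (i j : 'I_3) : mderiv i ('X_j : {mpoly F[3]}) = (j == i)%:R.
Proof.
rewrite mderivX mnm1E; case: eqP => [->|_]; last by rewrite scale0r.
rewrite scale1r -[RHS]mpolyX0; congr 'X_[_]; apply/mnmP => l.
by rewrite mnmBE subnn mnm0E.
Qed.

Lemma mderiv_cubm k i : mderiv i (cubm k) = grad (kC k) (@Xv F) i.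
Proof.
move: i; apply: ord3P; rewrite /cubm /cub /grad /vec3 /kC /Xv /=;
 rewrite !(mderivD, mderivM, mderivC, exprS, expr0, mulr1) !mderiv_var /=; ring.
Qed.

Lemma map_cubm (L : fieldType) (f : {rmorphism F -> L}) k :
  map_mpoly f (cubm k) = cubm (f \o k).
Proof.
rewrite /cubm (rmorph_cub (map_mpoly f)); apply: eq_cub => [n|i] /=.
  by rewrite map_mpolyC.
by rewrite map_mpolyX.
Qed.

Lemma meval_grad k i (v : 'I_3 -> F) : (grad (kC k) (@Xv F) i).@[v] = grad k v i.
Proof.
rewrite (rmorph_grad (meval v)).
by move: i; apply: ord3P; rewrite /grad /vec3 /= /kC /Xv !mevalC !mevalXU.
Qed.

End Substitution.

Definition smooth_coef (F : fieldType) (k : nat -> F) : Prop :=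
  forall (L : fieldType) (f : {rmorphism F -> L}) (v : 'I_3 -> L),
    cub (f \o k) v = 0 -> (forall i, grad (f \o k) v i = 0) -> v =1 fun=> 0.

Lemma singular_at_cubm (F L : fieldType) (f : {rmorphism F -> L}) k v :
  singular_at f (cubm k) v <->
  cub (f \o k) v = 0 /\ forall i, grad (f \o k) v i = 0.
Proof.
rewrite /singular_at map_cubm meval_cubm; split=> [] [-> H]; split=> // i.
  by rewrite -(H i) mderiv_cubm meval_grad.
by rewrite mderiv_cubm meval_grad.
Qed.

Lemma smooth_cubicP (F : fieldType) (P : {mpoly F[3]}) :
  smooth_cubic P -> exists2 k, P = cubm k & smooth_coef k.
Proof.
move=> [[P0 hP] smP]; have [k EP] := dhomog3_cubm hP; exists k => // L f v v0 g0 i.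
apply/eqP/negPn/negP => vi.
by apply: (smP L f v); [exists i | rewrite EP; apply/singular_at_cubm].
Qed.

Lemma cubm_homog (F : fieldType) (k : nat -> F) : cubm k \is 3.-homog.
Proof.
have hX (i : 'I_3) : ('X_i : {mpoly F[3]}) \is 1.-homog.
  by rewrite dhomogX; apply/eqP; apply: mdeg1.
have hM (c : F) (p : {mpoly F[3]}) : p \is 3.-homog -> c%:MP * p \is 3.-homog.
  by rewrite mul_mpolyC; apply: dhomogZ.
rewrite /cubm /cub /kC /Xv -!mulrA !exprS !expr0 !mulr1.
have h3 i j l : ('X_i * ('X_j * 'X_l) : {mpoly F[3]}) \is 3.-homog.
  by rewrite -[X in X.-homog]/(1 + (1 + 1))%N !dhomogM.
by rewrite -?mulrA !rpredD // hM.
Qed.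

Lemma smooth_cubm (F : fieldType) (k : nat -> F) :
  smooth_coef k -> smooth_cubic (cubm k).
Proof.
move=> sm; split; last first.
  by move=> L f v [i vi] /singular_at_cubm [c0 g0]; rewrite (sm L f v c0 g0) eqxx in vi.
split; last exact: cubm_homog.
(* Were the form zero, every vector would be singular; (1, 1, 1) serves as witness. *)
apply/eqP => E; have := sm F idfun (fun=> 1) _ _ o0 => H.
suff: (1 : F) = 0 by apply/eqP/oner_neq0.
apply: H => [|i]; first by rewrite -[LHS]meval_cubm E meval0.
by rewrite -[LHS]meval_grad -mderiv_cubm E mderiv0 meval0.
Qed.

Lemma ldr_of_coef (F : fieldType) (k : nat -> F) :
  k 0%N = 0 -> k 2 = 0 -> k 6 = 0 -> has_ldr (cubm k).
Proof.
move=> k0 k2 k6.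
pose lin (r s t : F) : {mpoly F[3]} :=
  r%:MP * 'X_o0 + s%:MP * 'X_o1 + t%:MP * 'X_o2.
pose M : 'M[{mpoly F[3]}]_3 := \matrix_(i, j) vec3
  (vec3 (lin 0 1 0) (lin 0 0 1) (lin 0 0 0) j)
  (vec3 (lin 0 0 0) (lin 1 0 0) (lin 0 0 1) j)
  (* Expansion along this row has the cofactors Z^2, - Y Z and X Y, which together carry the seven
     remaining monomials. *)
  (vec3 (lin (k 5) (k 8) (k 9)) (lin 0 (- k 7) 0) (lin (k 1%N) (k 3) (k 4)) j) i.
exists M, 1; split; first exact: oner_neq0.
split; last first.
  rewrite scale1r det_mx33 /det3 /cross /dot !mxE /vec3 /= /lin /cubm /cub /kC /Xv.
  rewrite k0 k2 k6 mpolyC0 mpolyC1 mpolyCN; ring.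
have hX (c : F) (i : 'I_3) : c%:MP * ('X_i : {mpoly F[3]}) \is 1.-homog.
  by rewrite mul_mpolyC dhomogZ // dhomogX; apply/eqP; apply: mdeg1.
have hl r s t : lin r s t \is 1.-homog by rewrite /lin !rpredD.
by move=> i j; rewrite mxE; move: i j; apply: ord3P; apply: ord3P; rewrite /vec3 /=.
Qed.

(** * Linear algebra in three coordinates *)

Section Vectors.
Variable K : fieldType.
Implicit Types a b c v : 'I_3 -> K.

Definition basis3 (i : 'I_3) : 'I_3 -> K := fun j => (i == j)%:R.

Lemma dot_basis3 v i : dot v (basis3 i) = v i.
Proof. by move: i; apply: ord3P; rewrite /dot /basis3 /=; ring. Qed.

Lemma eq0_vec3 v : v o0 = 0 -> v o1 = 0 -> v o2 = 0 -> v =1 fun=> 0.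
Proof. by move=> *; apply: ord3P. Qed.

Lemma vec3_eq0_or v : v =1 (fun=> 0) \/ exists i, v i != 0.
Proof.
case: (eqVneq (v o0) 0) => [e0|]; last by right; exists o0.
case: (eqVneq (v o1) 0) => [e1|]; last by right; exists o1.
case: (eqVneq (v o2) 0) => [e2|]; last by right; exists o2.
by left; apply: eq0_vec3.
Qed.

Lemma neq0_vec3 v : ~ v =1 (fun=> 0) -> exists i, v i != 0.
Proof. by case: (vec3_eq0_or v). Qed.

Lemma cross_eq0 a b : ~ a =1 (fun=> 0) -> cross a b =1 (fun=> 0) ->
  exists s, b =1 (fun i => s * a i).
Proof.
move=> /neq0_vec3 [i ai] H; exists (b i / a i) => j.
apply: (mulIf ai); rewrite mulrAC divfK //.
(* The added term is the minor a_i b_j - a_j b_i, written as a value of [cross a b]. *)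
transitivity (b i * a j + dot (cross a b) (cross (basis3 i) (basis3 j))).
  by move: i j {ai}; apply: ord3P; apply: ord3P;
    rewrite /dot /cross /vec3 /basis3 /=; ring.
by rewrite /dot !H !mul0r !addr0.
Qed.

Lemma indep_exists_basis a b : ~ cross a b =1 (fun=> 0) ->
  exists e, det3 a b e != 0.
Proof.
by move=> /neq0_vec3 [i ci]; exists (basis3 i); rewrite /det3 dot_basis3.
Qed.

(** Cramer's rule: [det3 a b c] times [v] is the combination of b x c, c x a, a x b with the three
    products as coefficients. *)
Lemma det3_span v a b c : det3 a b c != 0 ->
  dot v a = 0 -> dot v b = 0 -> dot v c = 0 -> v =1 fun=> 0.
Proof.
move=> D va vb vc i; apply: (mulfI D); rewrite mulr0.
transitivity (dot v a * cross b c i + dot v b * cross c a i + dot v c * cross a b i);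
  last by rewrite va vb vc !mul0r !addr0.
by move: i; apply: ord3P; rewrite /det3 /dot /cross /vec3 /=; ring.
Qed.

Lemma indep_span n a b c : ~ n =1 (fun=> 0) ->
  dot n a = 0 -> dot n b = 0 -> dot n c = 0 -> ~ cross a b =1 (fun=> 0) ->
  exists s t, c =1 (fun i => s * a i + t * b i).
Proof.
move=> n0 na nb nc /neq0_vec3 [i ci].
have D : det3 a b c = 0.
  by apply/eqP/negPn/negP => D; apply: n0; apply: (det3_span D).
exists (cross c b i / cross a b i), (cross a c i / cross a b i) => j.
apply: (mulIf ci); rewrite mulrDl (mulrAC _ (a j)) (mulrAC _ (b j)) !divfK //.
transitivity (cross c b i * a j + cross a c i * b j + det3 a b c * (i == j)%:R).
  by move: i j {ci}; apply: ord3P; apply: ord3P;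
    rewrite /det3 /dot /cross /vec3 /=; ring.
by rewrite D mul0r addr0.
Qed.

End Vectors.

Definition nonsing (K : fieldType) (k : nat -> K) : Prop :=
  forall v, cub k v = 0 -> (forall i, grad k v i = 0) -> v =1 fun=> 0.

Lemma binary_quadratic_root (L : closedFieldType) (A B C : L) :
  exists s t, ~ (s = 0 /\ t = 0) /\ s ^+ 2 * A + s * t * B + t ^+ 2 * C = 0.
Proof.
have [A0|A0] := eqVneq A 0.
  exists 1, 0; split; first by case=> /eqP; rewrite oner_eq0.
  by rewrite A0; ring.
pose p := Poly [:: C; B; A].
have sp : size p = 3 by rewrite (@PolyK _ 0).
have /closed_rootP [s /rootP ps] : size p != 1 by rewrite sp.
exists s, 1; split; first by case=> _ /eqP; rewrite oner_eq0.
by rewrite -[RHS]ps horner_coef sp big_ord3 !coef_Poly /=; ring.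
Qed.

(** Otherwise the line ab lies in the cubic. At each of its points the gradient is orthogonal to [a]
    and [b], and its product with a third vector is a binary quadratic form on the line; a zero of
    that form is a singular point. *)
Lemma nonsing_no_line (L : closedFieldType) (k : nat -> L) (a b : 'I_3 -> L) :
  nonsing k -> ~ cross a b =1 (fun=> 0) -> cub k a = 0 -> cub k b = 0 ->
  pol k a b = 0 -> pol k b a <> 0.
Proof.
move=> ns ab ka kb pab pba; have [e De] := indep_exists_basis ab.
have indep s t : (fun i => s * a i + t * b i) =1 (fun=> 0) -> s = 0 /\ t = 0.
  move=> h; have h' i : s * a i + t * b i = 0 by apply: h.
  split; apply: (mulfI De); rewrite mulr0.
    transitivity (dot (fun i => s * a i + t * b i) (cross b e)).
      by rewrite /det3 /dot /cross /vec3 /=; ring.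
    by rewrite /dot /= !h' !mul0r !addr0.
  transitivity (dot (fun i => s * a i + t * b i) (cross e a)).
    by rewrite /det3 /dot /cross /vec3 /=; ring.
  by rewrite /dot /= !h' !mul0r !addr0.
have [s [t [st0 pe]]] : exists s t, ~ (s = 0 /\ t = 0) /\
    s ^+ 2 * pol k a e + s * t * tri k a b e + t ^+ 2 * pol k b e = 0.
  exact: binary_quadratic_root.
pose u i := s * a i + t * b i.
have ku : cub k u = 0 by rewrite cub_comb ka kb pab pba; ring.
apply: st0; apply: indep; apply: (ns _ ku).
apply: (det3_span De).
- rewrite -[LHS]/(pol k u a) pol_combl tri_diag13 pol_diag ka pab pba.
  by rewrite !mul0rn !mulr0 !addr0.
- rewrite -[LHS]/(pol k u b) pol_combl tri_diag23 pol_diag kb pab pba.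
  by rewrite !mul0rn !mulr0 !addr0.
- by rewrite -[LHS]/(pol k u e) pol_combl.
Qed.

Lemma smooth_nonsing (F L : fieldType) (f : {rmorphism F -> L}) (k : nat -> F) :
  smooth_coef k -> nonsing (f \o k).
Proof. by move=> sm v; apply: sm. Qed.

(** A Weierstrass shape: (1 : 0 : 0) is a smooth point whose tangent Z = 0 meets the cubic only
    there, and it is the only rational point. *)
Definition flex_form (F : fieldType) (k : nat -> F) : Prop :=
  [/\ [/\ k 0%N = 0, k 1%N = 0 & k 3 = 0], k 2 != 0, k 6 != 0 &
      forall x y, cub k (vec3 x y 1) != 0].

Lemma flex_form_eval (F : fieldType) (k : nat -> F) x y : flex_form k ->
  k 2 * x ^+ 2 + (k 4 * y + k 5) * x
  + (k 6 * y ^+ 3 + k 7 * y ^+ 2 + k 8 * y + k 9) != 0.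
Proof.
move=> [[k0 k1 k3] _ _ /(_ x y)]; congr (_ != 0).
by rewrite /cub /vec3 /= k0 k1 k3; ring.
Qed.

(** * Coordinates adapted to rational points *)

Section Normalisation.
Variable F : finFieldType.
Variable k : nat -> F.
Hypothesis smk : smooth_coef k.

Lemma smooth_no_line (a b : 'I_3 -> F) :
  ~ cross a b =1 (fun=> 0) -> cub k a = 0 -> cub k b = 0 ->
  pol k a b = 0 -> pol k b a != 0.
Proof.
have [L [f _]] := countable_algebraic_closure F.
move=> ab ka kb pab; apply/eqP => pba.
have ns := @smooth_nonsing F L f k smk.
apply: (nonsing_no_line (a := f \o a) (b := f \o b) ns);
  rewrite -?rmorph_cub -?rmorph_pol ?ka ?kb ?pab ?pba ?rmorph0 //.
move=> h; apply: ab => i; apply: (fmorph_inj f); rewrite rmorph0 -(h i).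
by move: i {h}; apply: ord3P; rewrite /cross /vec3 /= rmorphB !rmorphM.
Qed.

Definition colmx (a b c : 'I_3 -> F) : 'M[F]_3 :=
  \matrix_(i, j) vec3 (a i) (b i) (c i) j.

Lemma colmx_unit a b c : det3 a b c != 0 -> colmx a b c \in unitmx.
Proof. by rewrite unitmxE det_mx33 unitfE /det3 /cross /dot /vec3 /= !mxE. Qed.

Lemma comp_cubm_colmx k' a b c :
  cubm k' \mPo lin_subst (colmx a b c) = cubm (subst_coef k' a b c).
Proof.
rewrite comp_cubm; congr (cubm _).
have Ea : (fun i => colmx a b c i o0) =1 a by move=> i; rewrite mxE.
have Eb : (fun i => colmx a b c i o1) =1 b by move=> i; rewrite mxE.
have Ec : (fun i => colmx a b c i o2) =1 c by move=> i; rewrite mxE.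
have kk : k' =1 k' by [].
rewrite /subst_coef /tri (eq_cub kk Ea) (eq_cub kk Eb) (eq_cub kk Ec).
rewrite (eq_pol kk Ea Eb) (eq_pol kk Ea Ec) (eq_pol kk Eb Ea) (eq_pol kk Eb Ec).
rewrite (eq_pol kk Ec Ea) (eq_pol kk Ec Eb).
rewrite [pol _ (fun i => _ + _) (_ ^~ o2)](@eq_pol _ k' k' _ (fun i => a i + b i) _ c) //.
by move=> i; rewrite Ea Eb.
Qed.

Lemma two_points_ldr (a b : 'I_3 -> F) :
  ~ cross a b =1 (fun=> 0) -> cub k a = 0 -> cub k b = 0 -> has_ldr (cubm k).
Proof.
wlog pab : a b / pol k a b != 0.
  move=> wl ab ka kb; have [pab|pab] := eqVneq (pol k a b) 0; last exact: (wl a b).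
  apply: (wl b a) => //; first exact: smooth_no_line.
  move=> h; apply: ab => i; rewrite -oppr0 -(h i).
  by move: i {h}; apply: ord3P; rewrite /cross /vec3 /=; ring.
move=> ab ka kb; have [e De] := indep_exists_basis ab.
(* Moving [e] along [b] puts [c] on the tangent line at [a], which removes X^2 Z, without changing
   the determinant. *)
pose c i := 1 * e i + (- (pol k a e / pol k a b)) * b i.
have pac : pol k a c = 0 by rewrite pol_comb mulNr divfK // mul1r subrr.
have Dc : det3 a b c != 0.
  rewrite (_ : det3 a b c = det3 a b e) // /c /det3 /dot /cross /vec3 /=; ring.
apply: (has_ldr_subst (colmx_unit Dc)).
by rewrite comp_cubm_colmx; apply: ldr_of_coef.
Qed.

(** The tangent line at [a] meets the cubic twice at [a], so its third intersection is rational and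
    must be [a] again: [a] is a flex. The new basis is [a], a point [b] of the tangent and a point
    [e] off it. *)
Lemma one_point_flex (a : 'I_3 -> F) : ~ a =1 (fun=> 0) -> cub k a = 0 ->
  (forall b, cub k b = 0 -> cross a b =1 (fun=> 0)) ->
  exists k' A, [/\ A \in unitmx, cubm k \mPo lin_subst A = cubm k' & flex_form k'].
Proof.
move=> a0 ka uniq_a.
have [e pae] : exists e, pol k a e != 0.
  have /neq0_vec3 [i gi] : ~ grad k a =1 (fun=> 0).
    move=> g0; apply: a0; apply: (@smooth_nonsing F F idfun k smk) => //.
  by exists (basis3 _ i); rewrite /pol dot_basis3.
have paa : pol k a a = 0 by rewrite pol_diag ka mul0rn.
have ae : ~ cross a e =1 (fun=> 0).
  move=> /(cross_eq0 a0) [s es]; move: pae.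
  rewrite (@eq_pol _ k k a a e (fun i => s * a i)) // polZr paa mulr0.
  by rewrite eqxx.
have [e' De'] := indep_exists_basis ae.
pose b i := 1 * e' i + (- (pol k a e' / pol k a e)) * e i.
have pab : pol k a b = 0 by rewrite pol_comb mulNr divfK // mul1r subrr.
have D : det3 a b e != 0.
  rewrite (_ : det3 a b e = - det3 a e e') ?oppr_eq0 //.
  rewrite /b /det3 /dot /cross /vec3 /=; ring.
have ab : ~ cross a b =1 (fun=> 0).
  by move=> h; move: D; rewrite /det3 /dot !h !mul0r !addr0 eqxx.
have kb : cub k b != 0 by apply/eqP => /uniq_a.
have pba : pol k b a = 0.
  apply/eqP/negPn/negP => pba.
  (* The third intersection of the tangent line with the cubic. *)
  pose p i := - cub k b * a i + pol k b a * b i.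
  have /uniq_a h : cub k p = 0 by rewrite cub_comb ka pab; ring.
  apply: ab => i; apply: (mulfI pba); rewrite mulr0 -(h i).
  by rewrite /p; move: i {h}; apply: ord3P; rewrite /cross /vec3 /=; ring.
exists (subst_coef k a b e), (colmx a b e); split; rewrite ?comp_cubm_colmx //.
  exact: colmx_unit.
split=> //.
move=> x y; apply/eqP => h.
have h' : cub k (fun i => x * a i + y * b i + 1 * e i) = 0.
  by rewrite cub_comb3 -[RHS]h [RHS]/cub /subst_coef /vec3 /=; ring.
have := uniq_a _ h' => h''; move: D.
rewrite (_ : det3 a b e = - dot (cross a (fun i => x * a i + y * b i + 1 * e i)) b).
  by rewrite /dot !h'' !mul0r !addr0 oppr0 eqxx.
by rewrite /det3 /dot /cross /vec3 /=; ring.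
Qed.

End Normalisation.

(** * Cubics with a single rational point over large fields *)

Section FiniteField.
Variable F : finFieldType.
Local Notation q := #|F|.

Lemma finField_card_pchar : exists p n, p \in [pchar F] /\ q = (p ^ n.+1)%N.
Proof.
have [p _ pF] := finPcharP F; exists p, (logn p q).-1; split=> //.
have E : q = (p ^ logn p q)%N := card_pprimeChar pF.
by rewrite prednK //; case: (logn p q) E (finNzRing_gt1 F) => // ->.
Qed.

Lemma finField_card0 : q%:R = 0 :> F.
Proof.
have [p [n [pF ->]]] := finField_card_pchar.
by rewrite natrX (pcharf0 pF) expr0n.
Qed.

(** Stated for every F-algebra because it is also applied to polynomials over a closure. *)
Lemma finField_Frobenius (R : comNzRingType) (f : {rmorphism F -> R}) (x y : R) :
  (x + y) ^+ q = x ^+ q + y ^+ q.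
Proof.
have [p [n [pF ->]]] := finField_card_pchar.
rewrite exprDn_pchar // pnatX (eq_pnat _ (pcharf_eq (rmorph_pchar f pF))).
by rewrite pnat_id ?(pcharf_prime pF).
Qed.

Lemma finField_fixed (L : fieldType) (f : {rmorphism F -> L}) (x : L) :
  x ^+ q = x -> exists a, x = f a.
Proof.
move=> xq; have := congr1 (fun p => (map_poly f p).[x]) (finField_genPoly F).
rewrite /= rmorphB /= map_polyXn map_polyX hornerD hornerN hornerXn hornerX xq subrr.
rewrite rmorph_prod horner_prod => /esym/eqP/prodf_eq0 [a _].
by rewrite rmorphB /= map_polyX map_polyC /= hornerXsubC subr_eq0 => /eqP; exists a.
Qed.

Lemma finField_all_roots (h : {poly F}) :
  (forall a, h.[a] = 0) -> exists g, h = ('X^q - 'X) * g.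
Proof.
move=> h0; have [||g ->] := @uniq_roots_prod_XsubC F h (index_enum F).
- by apply/allP => a _; apply/rootP.
- by rewrite uniq_rootsE index_enum_uniq.
by exists g; rewrite finField_genPoly mulrC.
Qed.

Lemma deriv_genPoly : ('X^q - 'X : {poly F})^`() = - 1.
Proof.
by rewrite derivB derivXn derivX -mulr_natr -polyC_natr finField_card0 mulr0 sub0r.
Qed.

Lemma size_genPoly : size ('X^q - 'X : {poly F}) = q.+1.
Proof. by rewrite size_polyDl size_polyXn // size_polyN size_polyX ltnS finNzRing_gt1. Qed.

(** Simple zeros give h = (X^q - X) g. As X^q - X has derivative -1, h' takes the value -g(a) at a,
    so g is divisible as well and h has a factor of degree 2 q. *)
Lemma double_roots_eq0 (h : {poly F}) :
  (forall a, h.[a] = 0) -> (forall a, h^`().[a] = 0) -> (size h <= q.*2)%N -> h = 0.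
Proof.
move=> h0; have [g ->] := finField_all_roots h0 => dh.
have /finField_all_roots [g' ->] : forall a, g.[a] = 0.
  move=> a; have := dh a; rewrite derivM deriv_genPoly !hornerE expf_card subrr.
  by rewrite mul0r addr0 mulN1r => /eqP; rewrite oppr_eq0 => /eqP.
have [-> | g0] := eqVneq g' 0; first by rewrite !mulr0.
have X0 : ('X^q - 'X : {poly F}) != 0 by rewrite -size_poly_eq0 size_genPoly.
rewrite !size_mul ?mulf_neq0 // size_genPoly.
have s0 : (0 < size g')%N by rewrite size_poly_gt0.
move=> le; exfalso; move: s0 le.
by move: #|F| (size _) => q s; lia.
Qed.

End FiniteField.

Lemma odd_card_finField (F : finFieldType) : (2 : F) != 0 -> odd #|F|.
Proof.
have [p [n [pF ->]]] := finField_card_pchar F => two; rewrite oddX /=.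
have [p2|//] := even_prime (pcharf_prime pF).
by rewrite p2 in pF; rewrite (pcharf0 pF) eqxx in two.
Qed.

(* Euler's criterion: a square root [r] of [z] in a closure satisfies
   [r ^+ #|F| = z ^+ m * r], so it is rational if [z ^+ m = 1]. *)
Lemma nonsquare_pow_half (F : finFieldType) (m : nat) (z : F) : #|F| = m.*2.+1 ->
  (forall r, r ^+ 2 != z) -> z ^+ m = - 1.
Proof.
move=> qm nsq; have z0 : z != 0 by rewrite eq_sym; have := nsq 0; rewrite expr0n.
have : (z ^+ m - 1) * (z ^+ m + 1) == 0.
  rewrite -subr_sqr expr1n -exprM muln2 subr_eq0; apply/eqP/(mulfI z0).
  by rewrite -exprS -qm expf_card mulr1.
rewrite mulf_eq0 subr_eq0 addr_eq0 => /orP [/eqP zm|/eqP//]; exfalso.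
have [L [f _]] := countable_algebraic_closure F.
have /closed_rootP [r] : size ('X^2 - (f z)%:P : {poly L}) != 1 by rewrite size_XnsubC.
rewrite /root !hornerE subr_eq0 => /eqP rz.
have [a ra] : exists a, r = f a.
  apply: finField_fixed.
  by rewrite qm exprS -mul2n exprM rz -rmorphXn zm rmorph1 mulr1.
by have := nsq a; rewrite -(inj_eq (fmorph_inj f)) rmorphXn /= -ra rz eqxx.
Qed.

(** The polynomial [h] vanishes doubly at each a: its derivative there is - f' + 2 m f^m f', which
    is 0 because 2 m = -1 and f^m = -1. Yet its degree 3 (m + 1) is below 2 q = 4 m + 2 once m >
    1. *)
Lemma cubic_pow_half_contra (F : finFieldType) (f : {poly F}) (m : nat) :
  #|F| = m.*2.+1 -> (1 < m)%N -> (2 : F) != 0 -> size f = 4 ->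
  ~ (forall a, f.[a] ^+ m = - 1).
Proof.
move=> qm m2 two sf fm.
pose h := f^`() * ('X^#|F| - 'X) + (f * (f ^+ m + 1)) *+ 2.
have h0 a : h.[a] = 0.
  by rewrite !(hornerE, horner_exp) /= expf_card fm subrr addNr !(mulr0, mul0rn, addr0).
have dh0 a : h^`().[a] = 0.
  rewrite derivD derivMn !derivM deriv_genPoly derivD derivC addr0 deriv_exp.
  have m0 : (0 < m)%N by apply: ltnW.
  have m_eq : m%:R *+ 2 = - 1 :> F.
    have := finField_card0 F; rewrite qm -addn1 natrD -addnn natrD -mulr2n => /eqP.
    by rewrite addr_eq0 => /eqP.
  have E : f.[a] * (f^`().[a] * f.[a] ^+ m.-1 *+ m) *+ 2 = f^`().[a].
    transitivity (f^`().[a] * (f.[a] * f.[a] ^+ m.-1) * (m%:R *+ 2)).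
      by rewrite -mulr_natr; ring.
    by rewrite -exprS prednK // fm m_eq mulrN1 mulrN1 opprK.
  rewrite !(hornerE, horner_exp, hornerMn) /= expf_card subrr fm addNr.
  rewrite !mulr0 add0r !addr0 mulrN1 -addrA -mulr2n E; exact: addNr.
have f0 : f != 0 by rewrite -size_poly_eq0 sf.
have sfX n : size (f ^+ n) = (n * 3).+1.
  by have := size_exp f n; rewrite sf mulnC => <-; rewrite prednK ?size_poly_gt0 ?expf_neq0.
have sf' : (size (f^`() * ('X^#|F| - 'X))%R <= m.*2 + 4)%N.
  apply: (leq_trans (size_polyMleq _ _)); rewrite size_genPoly qm.
  have := lt_size_deriv f0; rewrite sf; move: (size _); clear; lia.
have Eh : h = f ^+ m.+1 *+ 2 + (f^`() * ('X^#|F| - 'X) + f *+ 2).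
  by rewrite /h exprS; ring.
have s2 : size (f ^+ m.+1 *+ 2) = (m.+1 * 3).+1.
  by rewrite -scaler_nat size_scale // sfX.
have slow : (size (f^`() * ('X^#|F| - 'X) + f *+ 2)%R < size (f ^+ m.+1 *+ 2)%R)%N.
  rewrite s2; apply: (leq_ltn_trans (size_polyD _ _)).
  rewrite gtn_max -[f *+ 2]scaler_nat size_scale // sf; apply/andP; split.
    by apply: (leq_ltn_trans sf'); move: m2; clear; lia.
  by move: m2; clear; lia.
have sh : size h = (m.+1 * 3).+1 by rewrite Eh size_polyDl // s2.
have : h = 0.
  by apply: double_roots_eq0 => //; rewrite sh qm; move: m2; clear; lia.
by move/eqP; rewrite -size_poly_eq0 sh.
Qed.


Lemma odd_no_flex_form (F : finFieldType) (k : nat -> F) :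
  (4 < #|F|)%N -> (2 : F) != 0 -> ~ flex_form k.
Proof.
move=> q4 two fk; have [_ k2 k6 _] := fk.
have [m qm] : exists m, #|F| = m.*2.+1.
  by exists (#|F|./2); rewrite -[LHS]odd_double_half odd_card_finField.
pose f : {poly F} := Poly [:: k 5 ^+ 2 - k 2 * k 9 *+ 4;
  k 4 * k 5 *+ 2 - k 2 * k 8 *+ 4; k 4 ^+ 2 - k 2 * k 7 *+ 4; - (k 2 * k 6 *+ 4)].
have f3 : - (k 2 * k 6 *+ 4) != 0.
  by rewrite oppr_eq0 -mulr_natr !mulf_neq0 // (natrM _ 2 2) mulf_neq0.
have sf : size f = 4 by rewrite (@PolyK _ 0).
have m2 : (1 < m)%N by rewrite qm in q4; move: q4; clear; lia.
apply: (cubic_pow_half_contra qm m2 two sf) => a.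
apply: nonsquare_pow_half => // r; apply/eqP => ra.
(* The quadratic formula: a square root [r] of the discriminant would give an affine point. *)
have /eqP := flex_form_eval ((r - (k 4 * a + k 5)) / (2 * k 2)) a fk; apply.
  apply: (mulfI k2); apply: (mulfI two); apply: (mulfI two); rewrite !mulr0.
  transitivity (r ^+ 2 - f.[a]); last by rewrite ra subrr.
  rewrite horner_coef sf !big_ord_recl big_ord0 !coef_Poly /=.
  by field; rewrite k2 two.
Qed.

(** * Characteristic two: trace and Artin-Schreier equations *)

Section CharTwo.
Variable R : comNzRingType.
Hypothesis two0 : (2 : R) = 0.

Lemma mulr2n_char2 (x : R) : x *+ 2 = 0.
Proof. by rewrite -mulr_natr two0 mulr0. Qed.

Lemma sqrrD_char2 (x y : R) : (x + y) ^+ 2 = x ^+ 2 + y ^+ 2.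
Proof. by rewrite sqrrD mulr2n_char2 addr0. Qed.

Lemma exprD_char2 (x y : R) i : (x + y) ^+ (2 ^ i) = x ^+ (2 ^ i) + y ^+ (2 ^ i).
Proof. by elim: i => // i IHi; rewrite expnSr !exprM IHi sqrrD_char2. Qed.

(** The absolute trace when #|F| = 2^n; as a formal sum it also applies to polynomials. *)
Definition trace2 n (x : R) : R := \sum_(i < n) x ^+ (2 ^ i).

Lemma trace2_artin_schreier n (x : R) :
  trace2 n (x ^+ 2 + x) = x ^+ (2 ^ n) + x.
Proof.
rewrite /trace2; elim: n => [|n IHn]; first by rewrite big_ord0 -mulr2n mulr2n_char2.
rewrite big_ord_recr /= IHn exprD_char2 -exprM -expnS.
transitivity (x ^+ (2 ^ n.+1) + x + x ^+ (2 ^ n) *+ 2); first by ring.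
by rewrite mulr2n_char2 addr0.
Qed.

Lemma trace2_sqr n (x : R) :
  trace2 n x ^+ 2 + trace2 n x = x ^+ (2 ^ n) + x.
Proof.
rewrite /trace2; elim: n => [|n IHn].
  by rewrite big_ord0 expr0n addr0 -mulr2n mulr2n_char2.
rewrite big_ord_recr /= sqrrD_char2 -exprM -expnSr addrACA IHn.
transitivity (x ^+ (2 ^ n.+1) + x + x ^+ (2 ^ n) *+ 2); first by ring.
by rewrite mulr2n_char2 addr0.
Qed.

End CharTwo.

Lemma rmorph_trace2 (R S : comNzRingType) (f : {rmorphism R -> S}) n x :
  f (trace2 n x) = trace2 n (f x).
Proof. by rewrite rmorph_sum; apply: eq_bigr => i _; rewrite rmorphXn. Qed.

Lemma deriv_trace2 (R : comNzRingType) (p : {poly R}) n : (2 : R) = 0 ->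
  (trace2 n.+1 p)^`() = p^`().
Proof.
move=> two0; have two0P : (2 : {poly R}) = 0 by rewrite -polyC_natr two0.
rewrite /trace2 raddf_sum big_ord_recl /= expr1 big1 ?addr0 // => i _.
by rewrite deriv_exp expnS mulrnA mulr2n_char2 ?mul0rn.
Qed.

Section EvenField.
Variable F : finFieldType.
Hypothesis two0 : (2 : F) = 0.

Lemma even_card_finField : exists n, #|F| = (2 ^ n.+1)%N.
Proof.
have [p [n [pF E]]] := finField_card_pchar F; exists n; rewrite E.
have /pcharf_eq h : 2 \in [pchar F] by rewrite inE /= two0 eqxx.
by have := pF; rewrite h inE => /eqP ->.
Qed.

Lemma even_sqrt (z : F) : exists r, r ^+ 2 = z.
Proof.
have [n qn] := even_card_finField; exists (z ^+ (2 ^ n)).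
by rewrite -exprM -expnSr -qn expf_card.
Qed.

(** The trace is 0 or 1. If it is 0, a root r of r^2 + r = z in a closure satisfies r^q + r = Tr(z)
    = 0 and is therefore rational. *)
Lemma trace2_eq1 n (z : F) : #|F| = (2 ^ n)%N ->
  (forall x, x ^+ 2 + x != z) -> trace2 n z = 1.
Proof.
move=> qn nz; have /eqP := trace2_sqr two0 n z.
rewrite -qn expf_card -mulr2n (mulr2n_char2 two0) -[X in _ + X]mulr1 expr2 -mulrDr.
rewrite mulf_eq0 => /orP [/eqP T0|]; last first.
  by rewrite addr_eq0 => /eqP ->; apply/eqP; rewrite eq_sym -subr_eq0 opprK -mulr2n two0.
have [L [f _]] := countable_algebraic_closure F; exfalso.
have two0L : (2 : L) = 0 by rewrite -(rmorph_nat f) two0 rmorph0.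
pose p : {poly L} := 'X^2 + 'X - (f z)%:P.
have /closed_rootP [r] : size p != 1.
  by rewrite /p -addrA size_polyDl ?size_XsubC ?size_polyXn.
rewrite /root /p !hornerE subr_eq0 => /eqP rz.
have [a ra] : exists a, r = f a.
  apply: finField_fixed; apply/eqP; rewrite -subr_eq0 qn.
  have -> : - r = r by apply/eqP; rewrite -subr_eq0 -opprD -mulr2n (mulr2n_char2 two0L) oppr0.
  by rewrite -(trace2_artin_schreier two0L) rz -rmorph_trace2 T0 rmorph0.
by have := nz a; rewrite -(inj_eq (fmorph_inj f)) rmorphD rmorphXn /= -ra rz eqxx.
Qed.

(** Tr(p) has derivative p', which cancels the value -p' coming from the other summand, so [h] has a
    double zero at every a. Its leading part p^(q/2) has degree 3 q / 2 < 2 q and dominates p' (x^q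
    - x), of degree at most q + 2, because q > 4. *)
Lemma cubic_trace2_contra (p : {poly F}) (n : nat) :
  #|F| = (2 ^ n)%N -> (2 < n)%N -> size p = 4 ->
  ~ (forall a, trace2 n p.[a] = 1).
Proof.
move=> qn n2 sp tp.
have two0P : (2 : {poly F}) = 0 by rewrite -polyC_natr two0.
case: n n2 qn tp => // n n2 qn tp.
pose h := trace2 n.+1 p + 1 + p^`() * ('X^#|F| - 'X).
have h0 a : h.[a] = 0.
  rewrite hornerD hornerM [('X^_ - 'X).[a]]hornerD hornerN hornerXn hornerX.
  rewrite expf_card subrr mulr0 addr0.
  rewrite hornerD hornerC /trace2 horner_sum.
  under eq_bigr => i _ do rewrite horner_exp.
  by rewrite -/(trace2 _ _) tp -mulr2n two0.
have dh0 a : h^`().[a] = 0.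
  rewrite !derivD deriv_trace2 // derivC derivM deriv_genPoly.
  rewrite !(hornerD, hornerM, hornerN, hornerXn, hornerX, hornerC) expf_card subrr.
  by rewrite mulr0 addr0 add0r mulrN1 subrr.
have p0 : p != 0 by rewrite -size_poly_eq0 sp.
have sX m : size (p ^+ m) = (m * 3).+1.
  by have := size_exp p m; rewrite sp mulnC => <-; rewrite prednK ?size_poly_gt0 ?expf_neq0.
have [s qs s4] : exists2 s, (2 ^ n)%N = s & (3 < s)%N.
  by exists (2 ^ n)%N => //; apply: (@leq_pexp2l 2 2 n).
have q2s : #|F| = s.*2 by rewrite qn expnS qs mul2n.
have slow m : (size (trace2 m p) <= (2 ^ m * 3)./2.+1)%N.
  rewrite /trace2; apply: (leq_trans (size_sum _ _ _)); apply/bigmax_leqP => i _.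
  rewrite sX ltnS geq_half_double.
  rewrite -mul2n mulnA -expnS leq_mul2r /= leq_pexp2l //.
have st : (size (p^`() * ('X^#|F| - 'X))%R <= s * 3)%N.
  apply: (leq_trans (size_polyMleq _ _)); rewrite size_genPoly q2s.
  by have := lt_size_deriv p0; rewrite sp; move: (size _) s4; clear; lia.
have sT : (size (trace2 n p + 1 + p^`() * ('X^#|F| - 'X))%R <= s * 3)%N.
  apply: (leq_trans (size_polyD _ _)); rewrite geq_max st andbT.
  apply: (leq_trans (size_polyD _ _)); rewrite geq_max size_poly1.
  rewrite (leq_trans (slow n)) ?qs; move: s4; clear; lia.
have Eh : h = p ^+ s + (trace2 n p + 1 + p^`() * ('X^#|F| - 'X)).
  by rewrite /h /trace2 big_ord_recr /= qs [_ + p ^+ s]addrC !addrA.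
have sh : size h = (s * 3).+1 by rewrite Eh size_polyDl sX.
have : h = 0.
  by apply: double_roots_eq0 => //; rewrite sh q2s; move: s4; clear; lia.
by move/eqP; rewrite -size_poly_eq0 sh.
Qed.

(** Every element is a square, so at a root of k4 y + k5 the equation in x would be solvable. That
    linear polynomial has no root, hence is a non-zero constant. *)
Lemma flex_form_char2 (k : nat -> F) : flex_form k -> k 4 = 0 /\ k 5 != 0.
Proof.
move=> fk; have [[k0 k1 k3] k2 k6 _] := fk.
have sol y : k 4 * y + k 5 != 0.
  apply/eqP => y0.
  pose C := k 6 * y ^+ 3 + k 7 * y ^+ 2 + k 8 * y + k 9.
  have [x xC] := even_sqrt (- C / k 2).
  have /eqP := flex_form_eval x y fk; apply; rewrite y0 xC mul0r addr0.
  by rewrite mulrCA divff // mulr1 addNr.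
have k5 : k 5 != 0 by have := sol 0; rewrite mulr0 add0r.
split=> //; apply/eqP/negPn/negP => k4; have := sol (- k 5 / k 4).
by rewrite mulrCA divff // mulr1 addNr eqxx.
Qed.

Lemma even_no_flex_form (k : nat -> F) : (4 < #|F|)%N -> ~ flex_form k.
Proof.
move=> q4 fk; have [k4 k5] := flex_form_char2 fk.
have [_ k2 k6 _] := fk.
(* With x replaced by (k5 / k2) x, multiplication by [c] brings the equation to x^2 + x + p(y). *)
pose c := k 2 / k 5 ^+ 2.
have c0 : c != 0 by rewrite mulf_neq0 // invr_eq0 expf_neq0.
pose p := Poly [:: c * k 9; c * k 8; c * k 7; c * k 6].
have sp : size p = 4 by rewrite (@PolyK _ 0) //= mulf_neq0.
have [n qn] := even_card_finField.
apply: (cubic_trace2_contra qn _ sp).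
  by rewrite qn in q4; case: n q4 {qn} => [|[|n]].
move=> a; apply: trace2_eq1 => // x; apply/eqP => xp.
have /eqP := flex_form_eval (k 5 / k 2 * x) a fk; apply.
apply: (mulfI c0); rewrite mulr0.
transitivity (x ^+ 2 + x + p.[a]).
  rewrite horner_coef sp !big_ord_recl big_ord0 !coef_Poly /= k4 /c.
  by field; rewrite k2 k5.
by rewrite xp -mulr2n (mulr2n_char2 two0).
Qed.

End EvenField.

(** * Determinantal representations and flexes *)

(* The substitution (1, T, T^4) separates the ten monomials. *)
Lemma cubm_inj (F : fieldType) (k k' : nat -> F) :
  cubm k = cubm k' -> forall n, (n < 10)%N -> k n = k' n.
Proof.
pose f : {rmorphism {mpoly F[3]} -> {poly F}} := mmap (@polyC F) (vec3 1 'X 'X^4).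
pose ex := nth 0%N [:: 0; 1; 4; 2; 5; 8; 3; 6; 9; 12]%N.
have fE g : f (cubm g) = \sum_(i < 10) (g i)%:P * 'X^(ex i).
  rewrite /cubm (rmorph_cub f) /cub /kC /Xv /= !mmapC !mmapX !mmap1U /vec3.
  by rewrite !big_ord_recl big_ord0 /=; ring.
move=> /(congr1 f); rewrite !fE => E.
have c g (i : 'I_10) : (\sum_(i < 10) (g i)%:P * 'X^(ex i) : {poly F})`_(ex i) = g i.
  rewrite coef_sum (bigD1 i) //= coefCM coefXn eqxx mulr1 big1 ?addr0 // => j ji.
  rewrite coefCM coefXn nth_uniq ?ltn_ord //=; case: eqP => [/val_inj e|_].
    by rewrite e eqxx in ji.
  by rewrite mulr0.
by move=> n hn; rewrite -(c k (Ordinal hn)) -(c k' (Ordinal hn)) E.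
Qed.

Lemma dhomog1_lin (F : fieldType) (P : {mpoly F[3]}) : P \is 1.-homog ->
  exists v : 'I_3 -> F, P = \sum_i v i *: 'X_i.
Proof.
move=> /dhomogP hP; rewrite [P]mpolyE.
have: forall m, m \in msupp P -> mdeg m = 1%N by [].
elim: (msupp P : seq _) => [|m s IHs] hs.
  by exists (fun=> 0); rewrite big_nil big1 // => i _; rewrite scale0r.
have [|v Ev] := IHs; first by move=> m' hm'; apply: hs; rewrite inE hm' orbT.
have /mdeg1P [i mi] : mdeg m == 1%N by rewrite hs ?inE ?eqxx.
exists (fun j => P@_m * (j == i)%:R + v j); rewrite big_cons Ev.
under [in RHS]eq_bigr => j _ do rewrite scalerDl.
rewrite big_split /=; congr (_ + _); rewrite (bigD1 i) //= eqxx mulr1 big1 ?addr0.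
  by rewrite (eqP mi).
by move=> j /negPf ->; rewrite mulr0 scale0r.
Qed.

Section Pencil.
Variable F : fieldType.
Implicit Types B D : 'M[F]_3.

Definition cdet (R : comNzRingType) (f g h : 'I_3 -> 'I_3 -> R) : R :=
  det3 (f^~ o0) (g^~ o1) (h^~ o2).

(** For f = g this is the sum of the two principal minors through the last index, the coefficient of
    X in the determinant of X [pid2] + f; two arguments allow the expansion at Y B + Z D. *)
Definition qmin (R : comNzRingType) (f g : 'I_3 -> 'I_3 -> R) : R :=
  f o0 o0 * g o2 o2 + f o1 o1 * g o2 o2 - f o0 o2 * g o2 o0 - f o1 o2 * g o2 o1.

Definition pencil_coef B D : nat -> F :=
  nth 0 [:: 0; B o2 o2; D o2 o2; qmin B B; qmin B D + qmin D B; qmin D D;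
            cdet B B B; cdet D B B + cdet B D B + cdet B B D;
            cdet B D D + cdet D B D + cdet D D B; cdet D D D].

Definition pid2 (R : comNzRingType) (i j : 'I_3) : R := ((i == j) && (i < 2)%N)%:R.

Lemma det_pencil B D (M : 'M[{mpoly F[3]}]_3) :
  (forall i j, M i j = pid2 _ i j * 'X_o0 + (B i j)%:MP * 'X_o1 + (D i j)%:MP * 'X_o2) ->
  \det M = cubm (pencil_coef B D).
Proof.
move=> EM; rewrite det_mx33 /cubm /cub /kC /pencil_coef /= /cdet /qmin.
rewrite /det3 /cross /dot /vec3 /= !EM /pid2 /= mpolyC0 /Xv.
ring.
Qed.

(* The row vector [s] makes the last entry of [s *m (x pid2 + y B + D)] vanish for all
   [x] and [y]; the two other entries are a regular linear system in [x], [y]. *)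
Lemma pencil_point B D c k : c != 0 ->
  (forall n, (n < 10)%N -> k n = c * pencil_coef B D n) ->
  k 1%N = 0 -> k 3 = 0 -> k 2 != 0 -> k 6 != 0 ->
  exists x y, cub k (vec3 x y 1) = 0.
Proof.
move=> c0 kE k1 k3 k2 k6.
have B22 : B o2 o2 = 0 by move/eqP: k1; rewrite kE // mulf_eq0 (negPf c0) => /eqP.
have D22 : D o2 o2 != 0 by move: k2; rewrite kE // mulf_eq0 (negPf c0).
have dB : cdet B B B != 0 by move: k6; rewrite kE // mulf_eq0 (negPf c0).
have qB : B o0 o2 * B o2 o0 = - (B o1 o2 * B o2 o1).
  move/eqP: k3; rewrite kE // mulf_eq0 (negPf c0) /pencil_coef /= /qmin B22 !mulr0.
  by rewrite addr0 add0r -opprD oppr_eq0 addr_eq0 => /eqP.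
pose w0 := B o2 o0; pose w1 := B o2 o1.
(* By [qB] and [B22] the vector [s] annihilates the last column of B whatever its third entry; [kap]
   makes it annihilate that of D. *)
pose kap := - (w0 * D o0 o2 + w1 * D o1 o2) / D o2 o2.
pose s := vec3 w0 w1 kap.
pose sB j := dot s (B^~ j); pose sD j := dot s (D^~ j).
pose Del := w0 * sB o1 - w1 * sB o0.
(* By this identity and the next, [Del] = 0 would kill the whole last row of B, against det B !=
   0. *)
have e0 : cdet B B B * w0 = B o1 o2 * Del.
  transitivity (B o1 o2 * Del + (B o0 o2 * B o2 o0 + B o1 o2 * B o2 o1)
    * (B o1 o0 * B o2 o1 - B o1 o1 * B o2 o0)).
    by rewrite /Del /sB /s /w0 /w1 /cdet /det3 /cross /dot /vec3 /= B22; ring.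
  by rewrite qB addNr mul0r addr0.
have e1 : cdet B B B * w1 = - (B o0 o2 * Del).
  transitivity (- (B o0 o2 * Del) - (B o0 o2 * B o2 o0 + B o1 o2 * B o2 o1)
    * (B o0 o0 * B o2 o1 - B o0 o1 * B o2 o0)).
    by rewrite /Del /sB /s /w0 /w1 /cdet /det3 /cross /dot /vec3 /= B22; ring.
  by rewrite qB addNr mul0r subr0.
have s0 : ~ s =1 (fun=> 0).
  move=> h; have h0 : w0 = 0 := h o0; have h1 : w1 = 0 := h o1.
  move: dB; rewrite /cdet /det3 /cross /dot /vec3 /= B22 -/w0 -/w1 h0 h1.
  by rewrite !(mul0r, mulr0, subr0, addr0) eqxx.
have Del0 : Del != 0.
  apply/eqP => Del0; apply: s0.
  have h0 : w0 = 0 by apply: (mulfI dB); rewrite e0 Del0 !mulr0.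
  have h1 : w1 = 0 by apply: (mulfI dB); rewrite e1 Del0 !mulr0 oppr0.
  by apply: eq0_vec3; rewrite /s /vec3 //= /kap h0 h1 !mul0r addr0 oppr0 mul0r.
pose x := (sD o1 * sB o0 - sD o0 * sB o1) / Del.
pose y := (sD o0 * w1 - sD o1 * w0) / Del.
exists x, y.
have -> : cub k (vec3 x y 1) =
   c * det3 (fun i => x * pid2 F i o0 + y * B i o0 + D i o0)
            (fun i => x * pid2 F i o1 + y * B i o1 + D i o1)
            (fun i => x * pid2 F i o2 + y * B i o2 + D i o2).
  rewrite /cub !kE // /pencil_coef /= /cdet /qmin /det3 /cross /dot /vec3 /= /pid2 /=; ring.
apply/eqP; rewrite mulf_eq0 (negPf c0) /=; apply/negPn/negP => Dn; apply: s0.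
apply: (det3_span Dn).
- transitivity (x * w0 + y * sB o0 + sD o0).
    by rewrite /sB /sD /s /dot /vec3 /= /pid2 /=; ring.
  by rewrite /x /y /Del; field.
- transitivity (x * w1 + y * sB o1 + sD o1).
    by rewrite /sB /sD /s /dot /vec3 /= /pid2 /=; ring.
  by rewrite /x /y /Del; field.
- transitivity (y * (B o0 o2 * B o2 o0 + B o1 o2 * B o2 o1)
    + (w0 * D o0 o2 + w1 * D o1 o2 + kap * D o2 o2)).
    by rewrite /s /dot /vec3 /= /pid2 /= B22 /w0 /w1; ring.
  by rewrite qB addNr mulr0 add0r /kap divfK // addrN.
Qed.

End Pencil.

Lemma mul_pencil (R : comNzRingType) (L U A B D M : 'M[R]_3) (x y z : R) :
  (forall i j, M i j = A i j * x + B i j * y + D i j * z) ->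
  forall i j, (L *m M *m U) i j =
  (L *m A *m U) i j * x + (L *m B *m U) i j * y + (L *m D *m U) i j * z.
Proof.
move=> ME i j; rewrite !mxE !big_distrl -!big_split /=; apply: eq_bigr => l _.
rewrite !mxE !big_distrl -!big_split /=; apply: eq_bigr => l' _.
by rewrite ME; ring.
Qed.

Lemma rank_normal_form (F : fieldType) (A : 'M[F]_3) :
  exists L U : 'M[F]_3, [/\ L \in unitmx, U \in unitmx & L *m A *m U = pid_mx (\rank A)].
Proof.
exists (invmx (col_ebase A)), (invmx (row_ebase A)).
rewrite !unitmx_inv col_ebase_unit row_ebase_unit; split=> //.
rewrite -{2}[A]mulmx_ebase !mulmxA mulVmx ?col_ebase_unit // mul1mx.
by rewrite -mulmxA mulmxV ?row_ebase_unit // mulmx1.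
Qed.

Lemma dhomog1_pencil (F : fieldType) (M : 'M[{mpoly F[3]}]_3) :
  (forall i j, M i j \is 1.-homog) -> exists A B D : 'M[F]_3, forall i j,
    M i j = (A i j)%:MP * 'X_o0 + (B i j)%:MP * 'X_o1 + (D i j)%:MP * 'X_o2.
Proof.
move=> hM.
have /fin_all_exists [g gE] : forall p : 'I_3 * 'I_3, exists v : 'I_3 -> F,
    M p.1 p.2 = \sum_i v i *: 'X_i by move=> p; apply: dhomog1_lin.
pose co l : 'M[F]_3 := \matrix_(i, j) g (i, j) l.
exists (co o0), (co o1), (co o2) => i j.
by rewrite (gE (i, j)) big_ord3 /= !mxE addrA -!mul_mpolyC.
Qed.

(** Row and column operations over F bring the coefficient matrix of X to normal form and change the
    determinant only by a constant. *)
Lemma ldr_normal_pencil (F : fieldType) (P : {mpoly F[3]}) : has_ldr P ->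
  exists (r : nat) (B D : 'M[F]_3) (M : 'M[{mpoly F[3]}]_3) (c : F),
  [/\ (r <= 3)%N, c != 0, P = c%:MP * \det M & forall i j,
    M i j = ((pid_mx r : 'M[F]_3) i j)%:MP * 'X_o0 + (B i j)%:MP * 'X_o1
            + (D i j)%:MP * 'X_o2].
Proof.
move=> [M [lam [lam0 [/dhomog1_pencil [A [B [D ME]]] ->]]]].
have [L [U [uL uU LAU]]] := rank_normal_form A.
pose C : {rmorphism F -> {mpoly F[3]}} := @mpolyC 3 F.
exists (\rank A), (L *m B *m U), (L *m D *m U).
exists (map_mx C L *m M *m map_mx C U), (lam / (\det L * \det U)).
have dL : \det L != 0 by rewrite -unitfE -unitmxE.
have dU : \det U != 0 by rewrite -unitfE -unitmxE.
split; first exact: rank_leq_row.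
- by rewrite !mulf_neq0 // invr_eq0 mulf_neq0.
- rewrite !det_mulmx !det_map_mx -mul_mpolyC.
  transitivity ((lam / (\det L * \det U) * \det L * \det U)%:MP * \det M).
    by congr (_%:MP * _); field; rewrite dL dU.
  by rewrite -![(C _)]/(_%:MP) !mpolyCM; ring.
move=> i j; have cE N : (map_mx C L *m map_mx C N *m map_mx C U) i j =
  ((L *m N *m U) i j)%:MP by rewrite -2!map_mxM mxE.
rewrite -LAU -!cE; apply: mul_pencil => i' j'; rewrite !mxE; exact: ME.
Qed.

(** The cubic passes through (1 : 0 : 0) and is smooth there. The first property makes the matrix
    singular at this point; the second excludes corank at least two, where the derivative of the
    determinant vanishes. So the rank is exactly 2, the case of [pencil_point]. *)
Lemma ldr_second_point (F : fieldType) (k : nat -> F) : has_ldr (cubm k) ->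
  k 0%N = 0 -> k 1%N = 0 -> k 3 = 0 -> k 2 != 0 -> k 6 != 0 ->
  exists x y, cub k (vec3 x y 1) = 0.
Proof.
move=> /ldr_normal_pencil [r [B [D [M [c [r3 c0 kM ME]]]]]] k0 k1 k3 k2 k6.
have [e [k0E k2E e0M]] : exists e, [/\ k 0%N = (cubm k).@[e],
    k 2 = (mderiv o2 (cubm k)).@[e] &
    forall i j, (M i j).@[e] = (pid_mx r : 'M[F]_3) i j].
  exists (vec3 1 0 0); split; last move=> i j.
  - by rewrite meval_cubm /cub /vec3 /=; ring.
  - by rewrite mderiv_cubm meval_grad /grad /vec3 /=; ring.
  - by rewrite ME !mevalD !mevalM !mevalC !mevalXU /vec3 /=; ring.
have dM i j : mderiv o2 (M i j) = (D i j)%:MP.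
  by rewrite ME !mderivD !mderiv_mulC !mderiv_var /=; ring.
have r2 : r = 2.
  move: k0E k2E k2; rewrite kM mderivM mderivC mul0r add0r !mevalM !mevalC det_mx33.
  rewrite /det3 /cross /dot /vec3 /= !(mderivD, mderivN, mderivM).
  rewrite !(mevalD, mevalN, mevalM) !dM !e0M !mevalC !mxE k0.
  case: r r3 {e0M kM ME} => [|[|[|[|//]]]] _ //= hk0 hk2.
  - by rewrite hk2 !(mul0r, mulr0, subr0, addr0, sub0r, oppr0) eqxx.
  - by rewrite hk2 !(mul0r, mulr0, subr0, addr0, sub0r, oppr0) eqxx.
  - move: hk0; rewrite !(mul0r, mulr0, subr0, addr0, add0r, mulr1) => /esym/eqP.
    by rewrite (negPf c0).
rewrite {r r3 e0M k0E k2E}r2 in ME.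
have kE n : (n < 10)%N -> k n = c * pencil_coef B D n.
  move: n; apply: (@cubm_inj F k (fun n => c * pencil_coef B D n)).
  rewrite kM (@det_pencil _ B D); last first.
    move=> i j; rewrite ME mxE /pid2; congr (_ * _ + _ + _).
    by rewrite (rmorph_nat (@mpolyC 3 F)).
  by rewrite /cubm /cub /kC !mpolyCM; ring.
exact: (pencil_point c0 kE).
Qed.

(** * Classification over the fields with at most four elements *)

Lemma eq_cubm (F : fieldType) (k k' : nat -> F) :
  (forall n, (n < 10)%N -> k n = k' n) -> cubm k = cubm k'.
Proof. by move=> e; rewrite /cubm /cub /kC !e. Qed.

Lemma cubmZ (F : fieldType) (k : nat -> F) (c : F) :
  c *: cubm k = cubm (fun n => c * k n).
Proof. by rewrite -mul_mpolyC /cubm /cub /kC !mpolyCM; ring. Qed.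

Definition coef2 (F : fieldType) : nat -> F := nth 0 [:: 0; 0; 1; 0; 0; 1; 1; 1; 0; 1].
Definition coef3 (F : fieldType) : nat -> F := nth 0 [:: 0; 0; 1; 0; 0; 0; 1; 0; -1; 1].
Definition coef4 (F : fieldType) (w : F) : nat -> F :=
  nth 0 [:: 0; 0; 1; 0; 0; 1; 1; 0; 0; w].

Lemma cubic_q2E (F : fieldType) : cubic_q2 F = cubm (coef2 F).
Proof.
rewrite /cubm /cub /kC /coef2 /= !mpolyC0 !mpolyC1 /Xv /cubic_q2 /cX /cY /cZ; ring.
Qed.

Lemma cubic_q3E (F : fieldType) : cubic_q3 F = cubm (coef3 F).
Proof.
rewrite /cubm /cub /kC /coef3 /= !mpolyC0 !mpolyCN !mpolyC1 /Xv /cubic_q3 /cX /cY /cZ.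
ring.
Qed.

Lemma cubic_q4E (F : fieldType) (w : F) : cubic_q4 w = cubm (coef4 w).
Proof.
rewrite /cubm /cub /kC /coef4 /= !mpolyC0 !mpolyC1 /Xv /cubic_q4 /cX /cY /cZ.
by rewrite -mul_mpolyC; ring.
Qed.

(** For identities that hold only in characteristic [m]. Each constant [c] supplied below is (x - y)
    / m computed over the integers, modulo the equations handed to [ring]. *)
Lemma eq_mod0 (R : comNzRingType) (m c x y : R) : m = 0 -> x = y + m * c -> x = y.
Proof. by move=> -> ->; rewrite mul0r addr0. Qed.

Lemma rmorph_eq0_nat (F L : fieldType) (f : {rmorphism F -> L}) n :
  n%:R = 0 :> F -> n%:R = 0 :> L.
Proof. by move=> n0; rewrite -(rmorph_nat f) n0 rmorph0. Qed.

(** In characteristic 2 the partial derivatives are Z^2, Y^2 and X^2 + Y^2 + Z^2. *)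
Lemma smooth_coef2 (F : fieldType) : (2 : F) = 0 -> smooth_coef (coef2 F).
Proof.
move=> /rmorph_eq0_nat two0 L f v _ g.
have t : (2 : L) = 0 := two0 L f.
have := g o0; have := g o1; have := g o2.
rewrite /grad /vec3 /= !rmorph0 !rmorph1 => g2 g1 g0.
have v2 : v o2 = 0 by apply/eqP; rewrite -sqrf_eq0 -g0; apply/eqP;
    apply: (eq_mod0 (c := - v o0 * v o2) t); ring.
have v1 : v o1 = 0 by apply/eqP; rewrite -sqrf_eq0 -g1; apply/eqP;
    apply: (eq_mod0 (c := - v o1 ^+ 2 - v o1 * v o2) t); ring.
have v0 : v o0 = 0 by apply/eqP; rewrite -sqrf_eq0 -g2 v1 v2; apply/eqP; ring.
exact: eq0_vec3.
Qed.

Lemma smooth_coef4 (F : fieldType) (w : F) : (2 : F) = 0 -> smooth_coef (coef4 w).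
Proof.
move=> /rmorph_eq0_nat two0 L f v _ g.
have t : (2 : L) = 0 := two0 L f.
have := g o0; have := g o1; have := g o2.
rewrite /grad /vec3 /= !rmorph0 !rmorph1 => g2 g1 g0.
have v2 : v o2 = 0 by apply/eqP; rewrite -sqrf_eq0 -g0; apply/eqP;
    apply: (eq_mod0 (c := - v o0 * v o2) t); ring.
have v1 : v o1 = 0 by apply/eqP; rewrite -sqrf_eq0 -g1; apply/eqP;
    apply: (eq_mod0 (c := - v o1 ^+ 2) t); ring.
have v0 : v o0 = 0 by apply/eqP; rewrite -sqrf_eq0 -g2 v1 v2; apply/eqP; ring.
exact: eq0_vec3.
Qed.

(** In characteristic 3 the gradient vanishes at (0 : 1 : 0); the equation itself excludes this
    point. *)
Lemma smooth_coef3 (F : fieldType) : (3 : F) = 0 -> smooth_coef (coef3 F).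
Proof.
move=> /rmorph_eq0_nat three0 L f v c g.
have t : (3 : L) = 0 := three0 L f.
have := g o0; have := g o1; have := g o2; move: c.
rewrite /cub /grad /vec3 /= !rmorph0 rmorphN !rmorph1 => c g2 g1 g0.
have v2 : v o2 = 0 by apply/eqP; rewrite -sqrf_eq0 -oppr_eq0 -g1; apply/eqP;
    apply: (eq_mod0 (c := - v o1 ^+ 2) t); ring.
have v0 : v o0 = 0 by apply/eqP; rewrite -sqrf_eq0 -g2 v2; apply/eqP; ring.
have v1 : v o1 = 0.
  have : v o1 ^+ 3 == 0 by rewrite -c v0 v2; apply/eqP; ring.
  by rewrite expf_eq0 => /eqP.
exact: eq0_vec3.
Qed.

Lemma no_ldr_of_no_affine_point (F : fieldType) (k : nat -> F) : flex_form k ->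
  ~ has_ldr (cubm k).
Proof.
move=> [[k0 k1 k3] k2 k6 no] /ldr_second_point h.
by have [x [y /eqP]] := h k0 k1 k3 k2 k6; rewrite (negPf (no x y)).
Qed.

Lemma flex_form_coef2 (F : finFieldType) : #|F| = 2%N -> flex_form (coef2 F).
Proof.
move=> q2; have e2 (x : F) : x ^+ 2 = x by rewrite -q2 expf_card.
split; rewrite /coef2 //= ?oner_eq0 // => x y.
have -> : cub (coef2 F) (vec3 x y 1) = 1 + 2 * (x + y).
  rewrite /cub /coef2 /vec3 /= exprS -!exprS; ring: (e2 x) (e2 y).
by rewrite -q2 finField_card0 mul0r addr0 oner_eq0.
Qed.

(** As y^3 = y, a point would give x^2 = -1, and -1 is not a square modulo 3. *)
Lemma flex_form_coef3 (F : finFieldType) : #|F| = 3%N -> flex_form (coef3 F).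
Proof.
move=> q3; have e3 (x : F) : x ^+ 3 = x by rewrite -q3 expf_card.
have t : 3 = 0 :> F by rewrite -q3 finField_card0.
split; rewrite /coef3 //= ?oner_eq0 // => x y; apply/eqP => h.
have hx : x ^+ 2 = -1.
  apply/eqP; rewrite -subr_eq0 opprK; apply/eqP; rewrite -h /cub /coef3 /vec3 /=.
  by rewrite (e3 y); ring.
have x0 : x = 0.
  have xN : - x = x by rewrite -[RHS]e3 exprS hx mulrN1.
  apply: (eq_mod0 (c := x) t); transitivity (x + (x - x)); first by ring.
  by rewrite xN; ring.
by move/eqP: hx; rewrite x0 expr0n /= eq_sym oppr_eq0 oner_eq0.
Qed.

(** x^2 + x and y^3 are a trace and a norm down to F_2, so their sum is idempotent, whereas [w] is
    not. *)
Lemma flex_form_coef4 (F : finFieldType) (w : F) : #|F| = 4%N ->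
  w ^+ 2 + w + 1 = 0 -> (2 : F) = 0 -> flex_form (coef4 w).
Proof.
move=> q4 hw t; have e4 (x : F) : x ^+ 4 = x by rewrite -q4 expf_card.
split; rewrite /coef4 //= ?oner_eq0 // => x y; apply/eqP.
rewrite /cub /vec3 /= => h.
pose z := x ^+ 2 + x + y ^+ 3.
have z2 : z ^+ 2 = z.
  rewrite /z; have -> : (x ^+ 2 + x + y ^+ 3) ^+ 2 =
    x ^+ 4 + x ^+ 2 + y ^+ 4 * y ^+ 2 + 2 * (x ^+ 3 + x ^+ 2 * y ^+ 3 + x * y ^+ 3) by ring.
  by rewrite (e4 x) (e4 y) t; ring.
have zw : w = z by apply: (eq_mod0 (c := - z) t); rewrite -[LHS]subr0 -h /z; ring.
move: hw; rewrite zw z2 -mulr2n -mulr_natr t mulr0 add0r => /eqP.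
by rewrite oner_eq0.
Qed.

Section Classification.
Variable F : finFieldType.
Implicit Types k : nat -> F.

Lemma proj_equiv_coefs k (a b c : 'I_3 -> F) k' s : det3 a b c != 0 -> s != 0 ->
  (forall n, (n < 10)%N -> subst_coef k a b c n = s * k' n) ->
  proj_equiv (cubm k) (cubm k').
Proof.
move=> D s0 e; exists (colmx a b c), s; split; first exact: colmx_unit.
split=> //; rewrite comp_cubm_colmx cubmZ; exact: eq_cubm.
Qed.

Lemma flex_form2_unique k : #|F| = 2%N -> flex_form k ->
  proj_equiv (cubm k) (cubm (coef2 F)).
Proof.
move=> q2 fk; have t : 2 = 0 :> F by rewrite -q2 finField_card0.
have e2 (x : F) : x != 0 -> x = 1.
  by move=> x0; apply: (mulfI x0); rewrite mulr1 -expr2 -q2 expf_card.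
have [k4 /e2 k5] := flex_form_char2 t fk.
have [[k0 k1 k3] /e2 k2 /e2 k6 _] := fk.
have /e2 k9 : k 9 != 0.
  by have := flex_form_eval 0 0 fk; congr (_ != 0); ring.
have /e2 k78 : k 7 + k 8 != 0.
  have := flex_form_eval 0 1 fk; congr (_ != 0); rewrite k6 k9.
  by apply: (eq_mod0 (c := 1) t); ring.
pose s := k 8.
have s2 : s ^+ 2 = s.
  by rewrite -q2 expf_card.
have k7 : k 7 = 1 - s by rewrite -k78 addrK.
(* For [s] = 0 the form is already the model; for [s] = 1 one has k 7 = 0, and Y -> Y + Z trades Y
   Z^2 for Y^2 Z. *)
apply: (@proj_equiv_coefs _ (vec3 1 0 0) (vec3 0 1 0) (vec3 0 s 1) _ 1).
- by rewrite /det3 /cross /dot /vec3 /= (_ : _ + _ = 1) ?oner_eq0 //; ring.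
- exact: oner_neq0.
move=> n hn.
rewrite /subst_coef /coef2 /tri /cub /pol /grad /dot /vec3 /=.
rewrite k0 k1 k3 k4 k2 k5 k6 k7 k9 -/s.
case: n hn => [|[|[|[|[|[|[|[|[|[|//]]]]]]]]]] _ /=.
all: try ring.
- by apply: (eq_mod0 (c := s) t); ring.
- by apply: (eq_mod0 (c := 2 * s) t); ring: s2.
- by apply: (eq_mod0 (c := s ^+ 2) t); ring.
Qed.

Lemma flex_form3_unique k : #|F| = 3%N -> flex_form k ->
  proj_equiv (cubm k) (cubm (coef3 F)).
Proof.
move=> q3 fk; have t : 3 = 0 :> F by rewrite -q3 finField_card0.
have two : (2 : F) != 0.
  apply/eqP => two; have : (3 : F) - 2 = 0 by rewrite t two subr0.
  by move/eqP; rewrite (_ : _ - _ = 1) ?oner_eq0 //; ring.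
have e3 (x : F) : x ^+ 3 = x by rewrite -q3 expf_card.
have e2 (x : F) : x != 0 -> x ^+ 2 = 1.
  by move=> x0; apply: (mulfI x0); rewrite -exprS e3 mulr1.
have [[k0 k1 k3] k2 k6 _] := fk.
pose s := k 2; pose u := k 4; pose v := k 5; pose d := s * k 6.
have s2 : s ^+ 2 = 1 := e2 _ k2.
have d2 : d ^+ 2 = 1 by apply: e2; rewrite mulf_neq0.
(* Replacing x by x + s (u y + v) completes the square, as 3 = 0; [s] times the equation becomes x^2
   + d y^3 + e y^2 + f y + g. *)
pose e := s * k 7 - u ^+ 2; pose f := s * k 8 - 2 * u * v; pose g := s * k 9 - v ^+ 2.
(* If x^2 + h is never 0 in F_3, then h is neither 0 nor -1, so h = 1. The coefficients follow from
   the values at 0, 1 and -1. *)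
have H y : d * y ^+ 3 + e * y ^+ 2 + f * y + g = 1.
  pose h := d * y ^+ 3 + e * y ^+ 2 + f * y + g.
  have H x : x ^+ 2 + h != 0.
    have sf := flex_form_eval (x + s * (u * y + v)) y fk.
    have := mulf_neq0 k2 sf; congr (_ != 0); rewrite -/s -/u -/v.
    apply: (eq_mod0 (c := s * (u * y + v) * x + (u * y + v) ^+ 2) t).
    by rewrite /h /d /e /f /g; ring: s2.
  have h0 : h != 0 by have := H 0; rewrite expr0n add0r.
  have h1 : h + 1 != 0 by have := H 1; rewrite expr1n addrC.
  have : h * (h + 1) * (h - 1) = 0.
    by transitivity (h ^+ 3 - h); [ring | rewrite e3 subrr].
  by move/eqP; rewrite !mulf_eq0 (negPf h0) (negPf h1) subr_eq0 => /eqP.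
have g1 : g = 1 by rewrite -(H 0); ring.
have e0 : e = 0.
  apply: (mulfI two); rewrite mulr0.
  transitivity ((d * 1 ^+ 3 + e * 1 ^+ 2 + f * 1 + g) - 1
    + ((d * (-1) ^+ 3 + e * (-1) ^+ 2 + f * (-1) + g) - 1)).
    by rewrite g1; ring.
  by rewrite !H subrr addr0.
have fd : f = - d.
  transitivity ((d * 1 ^+ 3 + e * 1 ^+ 2 + f * 1 + g) - 1 - d).
    by rewrite g1 e0; ring.
  by rewrite H subrr sub0r.
have k6E : k 6 = s * d by rewrite /d mulrA -expr2 s2 mul1r.
have k7E : k 7 = s * u ^+ 2.
  transitivity (s * (s * k 7 - u ^+ 2) + s * u ^+ 2); first by ring: s2.
  by rewrite -/e e0 mulr0 add0r.
have k8E : k 8 = s * (2 * u * v - d).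
  transitivity (s * (s * k 8 - 2 * u * v) + s * (2 * u * v)); first by ring: s2.
  by rewrite -/f fd; ring.
have k9E : k 9 = s * (1 + v ^+ 2).
  transitivity (s * (s * k 9 - v ^+ 2) + s * v ^+ 2); first by ring: s2.
  by rewrite -/g g1; ring.
(* The shift completes the square, and Y -> d Y turns d (Y^3 - Y Z^2) into Y^3 - Y Z^2 because d^2 =
   1. *)
apply: (@proj_equiv_coefs _ (vec3 1 0 0) (vec3 (u * s * d) d 0) (vec3 (v * s) 0 1) _ s).
- rewrite /det3 /cross /dot /vec3 /= (_ : _ + _ = d); last by ring.
  by rewrite mulf_neq0.
- exact: k2.
move=> n hn.
rewrite /subst_coef /coef3 /tri /cub /pol /grad /dot /vec3 /=.
rewrite k0 k1 k3 k6E k7E k8E k9E -/s -/u -/v.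
move: s u v d s2 d2 {fd f g e e0 g1 H k6E k7E k8E k9E} => s u v d s2 d2.
case: n hn => [|[|[|[|[|[|[|[|[|[|//]]]]]]]]]] _ /=.
all: try ring.
- by apply: (eq_mod0 (c := u * d) t); ring: s2 d2.
- by apply: (eq_mod0 (c := v) t); ring: s2 d2.
- by ring: s2 d2.
- by apply: (eq_mod0 (c := s * u ^+ 2) t); ring: s2 d2.
- by apply: (eq_mod0 (c := 2 * u * v * s * d) t); ring: s2 d2.
- by apply: (eq_mod0 (c := s * v ^+ 2) t); ring: s2 d2.
Qed.

Lemma flex_form4_unique k (w : F) : #|F| = 4%N -> w ^+ 2 + w + 1 = 0 ->
  flex_form k -> proj_equiv (cubm k) (cubm (coef4 w)).
Proof.
move=> q4 hw fk.
have t : 2 = 0 :> F.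
  have := finField_card0 F; rewrite q4 (natrM _ 2 2) => /eqP.
  by rewrite mulf_eq0 orbb => /eqP.
have w2 : w ^+ 2 = w + 1.
  apply: (eq_mod0 (c := - (w + 1)) t).
  by transitivity (w ^+ 2 + w + 1 - (w + 1)); [ring | rewrite hw; ring].
have e4 (x : F) : x ^+ 4 = x by rewrite -q4 expf_card.
have e3 (x : F) : x != 0 -> x ^+ 3 = 1.
  by move=> x0; apply: (mulfI x0); rewrite -exprS e4 mulr1.
have [k4 k5] := flex_form_char2 t fk.
have [[k0 k1 k3] k2 k6 _] := fk.
pose a := k 2; pose r := k 5 / a; pose c := a * r ^+ 2.
have r0 : r != 0 by rewrite mulf_neq0 // invr_eq0.
have c0 : c != 0 by rewrite mulf_neq0 // expf_neq0.
have k5E : k 5 = a * r by rewrite /r mulrCA divff // mulr1.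
pose d := k 6 / c; pose e := k 7 / c; pose f := k 8 / c; pose g := k 9 / c.
have cE z : z = c * (z / c) by rewrite mulrCA divff // mulr1.
(* Scaling x by [r] and dividing by [c] brings the equation to x^2 + x + p(y). *)
pose p y := d * y ^+ 3 + e * y ^+ 2 + f * y + g.
(* On F_4 the map x^2 + x has image F_2, so p takes only the values w and w + 1, the roots of z^2 +
   z = 1. *)
have H y : p y ^+ 2 + p y = 1.
  have Hx x : x ^+ 2 + x + p y != 0.
    have sf := flex_form_eval (r * x) y fk.
    have : c * (x ^+ 2 + x + p y) != 0.
      move: sf; congr (_ != 0); rewrite k4 k5E -/a (cE (k 6)) (cE (k 7)) (cE (k 8)) (cE (k 9)).
      by rewrite /p -/d -/e -/f -/g /c; ring.
    by rewrite mulf_eq0 (negPf c0).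
  have p0 : p y != 0 by have := Hx 0; rewrite expr0n !add0r.
  have p1 : p y - 1 != 0.
    have := Hx w; congr (_ != 0); apply: (eq_mod0 (c := w + 1) t).
    by rewrite w2; ring.
  have : (p y - 1) * (p y ^+ 2 + p y + 1) = 0.
    by transitivity (p y ^+ 3 - 1); [ring | rewrite e3 // subrr].
  move/eqP; rewrite mulf_eq0 (negPf p1) addr_eq0 => /eqP ->.
  by apply: (eq_mod0 (c := -1) t); ring.
have g1 : g ^+ 2 + g = 1 by rewrite -(H 0) /p; ring.
(* Modulo y^3 = 1, the difference p^2 + p - (g^2 + g) is d^2 + d + B y + C y^2. It vanishes at the
   three cube roots of unity, so its coefficients are 0. *)
pose B := e ^+ 2 + f; pose C := e + f ^+ 2.
have Hy y : y ^+ 3 = 1 -> d ^+ 2 + d + B * y + C * y ^+ 2 = 0.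
  move=> y3; have y4 := e4 y.
  have : p y ^+ 2 + p y - (g ^+ 2 + g) = 0 by rewrite H g1 subrr.
  move=> <-; rewrite /p y3.
  apply: (eq_mod0 (c := - (d * e * y ^+ 2 + d * f * y + d * g + e * f
    + e * g * y ^+ 2 + f * g * y)) t).
  rewrite /B /C; ring: y3 y4.
have h1 := Hy 1 (expr1n _ _).
have w3 : w ^+ 3 = 1.
  by rewrite exprS w2; apply: (eq_mod0 (c := w) t); ring: w2.
have hw1 := Hy w w3.
have hw2 := Hy (w ^+ 2) _.
have {}hw2 : d ^+ 2 + d + B * w ^+ 2 + C * (w ^+ 2) ^+ 2 = 0.
  by apply: hw2; rewrite -exprM mulnC exprM w3 expr1n.
have d1 : d ^+ 2 + d = 0.
  transitivity ((d ^+ 2 + d + B * 1 + C * 1 ^+ 2) + (d ^+ 2 + d + B * w + C * w ^+ 2)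
    + (d ^+ 2 + d + B * w ^+ 2 + C * (w ^+ 2) ^+ 2)); last first.
    by rewrite h1 hw1 hw2 !addr0.
  apply: (eq_mod0 (c := - (d ^+ 2 + d) - B * (w + 1) - C * (2 * w + 2)) t).
  by ring: w2.
have B0 : B = 0.
  transitivity ((d ^+ 2 + d + B * w + C * w ^+ 2) - w ^+ 2 * (d ^+ 2 + d + B * 1 + C * 1 ^+ 2)).
    rewrite d1; apply: (eq_mod0 (c := B) t); rewrite w2.
    by ring.
  by rewrite h1 hw1 mulr0 subr0.
have d1' : d = 1.
  have d0 : d != 0 by rewrite mulf_neq0 // invr_eq0.
  apply: (mulfI d0); apply: (eq_mod0 (c := - d) t).
  by rewrite mulr1 -[RHS]add0r -d1; ring.
have fE : f = e ^+ 2.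
  by apply: (eq_mod0 (c := - e ^+ 2) t); rewrite -[RHS]add0r -B0 /B; ring.
(* [g] is w or w + 1, so g + w lies in F_2, the image of s^2 + s. *)
have [s sE] : exists s, s ^+ 2 + s = g + w.
  have : (g - w) * (g + w + 1) = 0.
    transitivity (g ^+ 2 + g - (w ^+ 2 + w)); first by ring.
    by rewrite g1 w2; apply: (eq_mod0 (c := - w) t); ring.
  move/eqP; rewrite mulf_eq0 subr_eq0 => /orP [/eqP ->|/eqP gw].
    by exists 0; apply: (eq_mod0 (c := - w) t); ring.
  exists w; rewrite w2; apply: (eq_mod0 (c := w + 1) t).
  by transitivity (w + 1 + w + (g + w + 1)); [rewrite gw addr0 | ring].
have ee := e4 e.
(* As e^4 = e, shifting x by e^2 Y contributes e Y^2 + e^2 Y and removes both middle terms at once;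
   the shift by [s] turns g into w. *)
apply: (@proj_equiv_coefs _ (vec3 r 0 0) (vec3 (r * e ^+ 2) 1 0) (vec3 (r * s) 0 1) _ c).
- rewrite /det3 /cross /dot /vec3 /= (_ : _ + _ = r) //; by ring.
- exact: c0.
have k6E : k 6 = c by rewrite (cE (k 6)) -/d d1' mulr1.
have k7E : k 7 = c * e := cE _.
have k8E : k 8 = c * e ^+ 2 by rewrite (cE (k 8)) -/f fE.
have k9E : k 9 = c * g := cE _.
move=> n hn.
rewrite /subst_coef /coef4 /tri /cub /pol /grad /dot /vec3 /=.
rewrite k0 k1 k3 k4 k5E k6E k7E k8E k9E -/a.
have gE : g = s ^+ 2 + s - w by rewrite sE addrK.
rewrite gE /c; move: (a) (r) (e) ee => a' r' e' ee.
case: n hn => [|[|[|[|[|[|[|[|[|[|//]]]]]]]]]] _ /=.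
all: try ring.
- by apply: (eq_mod0 (c := a' * r' ^+ 2 * e' ^+ 2) t); ring.
- by apply: (eq_mod0 (c := a' * r' ^+ 2 * s) t); ring.
- by apply: (eq_mod0 (c := a' * r' ^+ 2 * e') t); ring: ee.
- by apply: (eq_mod0 (c := a' * r' ^+ 2 * e' ^+ 2 * (s + 1)) t); ring.
- by apply: (eq_mod0 (c := a' * r' ^+ 2 * (s ^+ 2 + s - w)) t); ring.
Qed.

End Classification.

Lemma ldr_or_flex_form (F : finFieldType) (k : nat -> F) (a : 'I_3 -> F) :
  smooth_coef k -> ~ a =1 (fun=> 0) -> cub k a = 0 ->
  has_ldr (cubm k) \/ exists2 k', flex_form k' & proj_equiv (cubm k) (cubm k').
Proof.
move=> smk a0 ka.
have [/existsP [b /andP [/eqP kb /existsP [i ci]]]|no] :=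
  boolP [exists b : {ffun 'I_3 -> F}, (cub k b == 0) && [exists i, cross a b i != 0]].
  by left; apply: (two_points_ldr smk _ ka kb) => h; rewrite h eqxx in ci.
right; have ua b : cub k b = 0 -> cross a b =1 (fun=> 0).
  move=> kb; have [//|[i ci]] := vec3_eq0_or (cross a b); case/negP: no.
  have bE : finfun b =1 b by apply: ffunE.
  apply/existsP; exists (finfun b); rewrite (eq_cub (frefl k) bE) kb eqxx /=.
  apply/existsP; exists i; move: ci.
  by rewrite /cross !bE.
have [k' [A [uA E fk']]] := one_point_flex smk a0 ka ua.
by exists k' => //; exists A, 1; rewrite oner_eq0 scale1r.
Qed.

(** * Existence of a rational point *)

Section Forms.
Variable F : fieldType.
Local Notation R := {mpoly F[3]}.
Implicit Types (S : pred 'I_3) (H K : R).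

(** Generation by constants, sums and multiplication by one variable lets divisions proceed by
    induction on the construction. [S] restricts the variables, and 0 is a form of every degree. *)
Inductive is_form S : nat -> R -> Prop :=
| form_0 d : is_form S d 0
| form_C c : is_form S 0 c%:MP
| form_D d H K : is_form S d H -> is_form S d K -> is_form S d (H + K)
| form_X d i H : S i -> is_form S d H -> is_form S d.+1 ('X_i * H).

Lemma form_scale S d H c : is_form S d H -> is_form S d (c%:MP * H).
Proof.
elim=> [?|c'|? ? ? _ ? _ ?|? i ? Si _ ?]; first by rewrite mulr0; apply: form_0.
  by rewrite -mpolyCM; apply: form_C.
  by rewrite mulrDr; apply: form_D.
by rewrite mulrCA; apply: form_X.
Qed.

Lemma form_mul S d e H K : is_form S d H -> is_form S e K -> is_form S (d + e) (H * K).
Proof.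
move=> + fK; elim=> [?|c|? ? ? _ ? _ ?|? i ? Si _ ?]; first by rewrite mul0r; apply: form_0.
  exact: form_scale.
  by rewrite mulrDl; apply: form_D.
by rewrite addSn -mulrA; apply: form_X.
Qed.

Lemma form_diff S d H K : is_form S d H -> is_form S d K -> is_form S d (H - K).
Proof.
move=> fH fK; apply: form_D => //.
by rewrite -mulN1r -mpolyC1 -mpolyCN; apply: form_scale.
Qed.

Lemma form_exp S d n H : is_form S d H -> is_form S (n * d) (H ^+ n).
Proof.
move=> fH; elim: n => [|n IHn]; first by rewrite expr0 -mpolyC1; apply: form_C.
by rewrite exprS mulSn; apply: form_mul.
Qed.

Lemma form_pow1 S d H : is_form S 1 H -> is_form S d (H ^+ d).
Proof. by move=> /(form_exp d); rewrite muln1. Qed.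

Lemma form_var S i : S i -> is_form S 1 'X_i.
Proof.
by move=> Si; rewrite -['X_i]mulr1 -mpolyC1; apply: form_X => //; apply: form_C.
Qed.

(* Forms of degree [D - s], only 0 being one when this is negative. *)
Definition zform S D s H := if (s <= D)%N then is_form S (D - s) H else H = 0.

Lemma zform0 S d s : zform S d s 0.
Proof. by rewrite /zform; case: ifP => // _; apply: form_0. Qed.

Lemma zformD S d s H K : zform S d s H -> zform S d s K -> zform S d s (H + K).
Proof.
rewrite /zform; case: ifP => _; first exact: form_D.
by move=> -> ->; rewrite addr0.
Qed.

Lemma zform_diff S d s H K : zform S d s H -> zform S d s K -> zform S d s (H - K).
Proof.
rewrite /zform; case: ifP => _; first exact: form_diff.
by move=> -> ->; rewrite subr0.
Qed.

Lemma zformM S d s e d' s' H K : (d' + s = d + e + s')%N ->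
  zform S d s H -> is_form S e K -> zform S d' s' (H * K).
Proof.
move=> E; rewrite /zform; case: ifP => [sd fH fK|_ -> _]; last first.
  by rewrite mul0r; apply: zform0.
have -> : (s' <= d')%N by move: E sd; clear; lia.
have -> : (d' - s' = d - s + e)%N by move: E sd; clear; lia.
exact: form_mul.
Qed.

End Forms.

Section Evaluation.
Variables (F : fieldType) (S : comNzRingType) (f : {rmorphism F -> S}).

Definition ev (v : 'I_3 -> S) : {rmorphism {mpoly F[3]} -> S} := mmap f v.

Lemma evC v c : ev v c%:MP = f c.
Proof. exact: mmapC. Qed.

Lemma evX v i : ev v 'X_i = v i.
Proof. by rewrite /ev /= mmapX mmap1U. Qed.

Lemma ev_cubm v k : ev v (cubm k) = cub (f \o k) v.
Proof.
rewrite /cubm rmorph_cub; apply: eq_cub => [n|i] /=; [exact: evC|exact: evX].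
Qed.

End Evaluation.

Lemma pol_form (F : fieldType) (k : nat -> F) (S : pred 'I_3) d e
  (a b : 'I_3 -> {mpoly F[3]}) :
  (forall i, is_form S d (a i)) -> (forall i, is_form S e (b i)) ->
  is_form S (2 * d + e) (pol (kC k) a b).
Proof.
move=> fa fb.
have h c i j : is_form S (2 * d) (c%:MP * (a i * a j)).
  by apply: form_scale; rewrite mul2n -addnn; apply: form_mul.
have fn H n m : is_form S m H -> is_form S m (H *+ n).
  move=> fH; elim: n => [|n IHn]; first by rewrite mulr0n; apply: form_0.
  by rewrite mulrS; apply: form_D.
have hg i : is_form S (2 * d) (grad (kC k) a i).
  move: i; apply: ord3P; rewrite /grad /vec3 /= /kC !exprS !expr0 !mulr1 -?mulrA;
   do 5?apply: form_D => //; do 1?apply: fn => //.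
by rewrite /pol /dot; do 2?apply: form_D; apply: form_mul.
Qed.

(** * Frobenius images and the third intersection point *)

Definition fr (S : comNzRingType) n (v : 'I_3 -> S) : 'I_3 -> S := fun i => v i ^+ n.

Lemma fr_fr (S : comNzRingType) n (v : 'I_3 -> S) : fr n (fr n v) =1 fr (n ^ 2) v.
Proof. by move=> i; rewrite /fr -exprM. Qed.

Section Frobenius.
Variables (F : finFieldType) (L : comNzRingType) (f : {rmorphism F -> L}).

(** The structure map is kept in the term so that x -> x^q can be declared a ring morphism:
    additivity comes from the F-algebra structure. *)
Definition frobq of {rmorphism F -> L} := fun x : L => x ^+ #|F|.

Fact frobq_additive : zmod_morphism (frobq f).
Proof.
move=> x y; rewrite /frobq (finField_Frobenius f); congr (_ + _).
have := finField_Frobenius f y (- y); rewrite subrr expr0n.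
have -> : (#|F| == 0)%N = false by apply/negbTE; rewrite -lt0n (ltn_trans _ (finNzRing_gt1 F)).
by rewrite /= => /esym/eqP; rewrite addrC addr_eq0 => /eqP.
Qed.

Fact frobq_multiplicative : monoid_morphism (frobq f).
Proof. by split=> [|x y]; rewrite /frobq ?expr1n ?exprMn. Qed.

HB.instance Definition _ := GRing.isZmodMorphism.Build L L (frobq f) frobq_additive.
HB.instance Definition _ := GRing.isMonoidMorphism.Build L L (frobq f) frobq_multiplicative.

Variable k : nat -> F.
Local Notation q := #|F|.
Local Notation kL := (f \o k).

Lemma frobq_coef n : frobq f (kL n) = kL n.
Proof. by rewrite /frobq /= -rmorphXn expf_card. Qed.

Lemma cub_fr v : cub kL (fr q v) = cub kL v ^+ q.
Proof.
transitivity (frobq f (cub kL v)); last by [].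
by rewrite rmorph_cub; apply: eq_cub => // n; rewrite /= -[RHS]/(frobq f (kL n)) frobq_coef.
Qed.

Lemma pol_fr u v : pol kL (fr q u) (fr q v) = pol kL u v ^+ q.
Proof.
transitivity (frobq f (pol kL u v)); last by [].
by rewrite rmorph_pol; apply: eq_pol => // n; rewrite /= -[RHS]/(frobq f (kL n)) frobq_coef.
Qed.

Lemma dot_fr (n : 'I_3 -> F) v : dot (f \o n) (fr q v) = dot (f \o n) v ^+ q.
Proof.
transitivity (frobq f (dot (f \o n) v)); last by [].
rewrite /dot !rmorphD !rmorphM /= -![frobq f (f (n _))]/(frobq f (f _)).
have e x : frobq f (f x) = f x by rewrite /frobq -rmorphXn expf_card.
by rewrite !e.
Qed.

End Frobenius.

(* [third_point] and [tangency] are the phi and G of the introduction. *)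
Definition third_point (S : comNzRingType) (k : nat -> S) (q : nat) (v : 'I_3 -> S) :=
  fun i => pol k (fr q v) v * v i + (- pol k v (fr q v)) * fr q v i.

Definition tangency (S : comNzRingType) (k : nat -> S) (q : nat) (v : 'I_3 -> S) : S :=
  pol k (third_point k q v) (fr (q ^ 2) v).

Section PointsOverClosure.
Variables (F : finFieldType) (k : nat -> F).
Hypothesis no_point : forall a, cub k a = 0 -> a =1 fun=> 0.
Local Notation q := #|F|.
Variables (L : fieldType) (f : {rmorphism F -> L}).
Local Notation kL := (f \o k).

Lemma rational_not_zero (v : 'I_3 -> L) (a : 'I_3 -> F) (s : L) :
  ~ v =1 (fun=> 0) -> cub kL v = 0 -> ~ v =1 (fun i => s * f (a i)).
Proof.
move=> v0 kv E; have [s0|s0] := eqVneq s 0.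
  by apply: v0 => i; rewrite E s0 mul0r.
apply: v0 => i; rewrite E.
suff /no_point -> : cub k a = 0 by rewrite rmorph0 mulr0.
apply: (fmorph_inj f); rewrite rmorph0 rmorph_cub; apply: (mulfI (expf_neq0 3 s0)).
by rewrite mulr0 -kv -cubZ; apply: eq_cub => // j; rewrite E.
Qed.

(** If b is proportional to [v], the ratios of coordinates of [v] are fixed by Frobenius, hence lie
    in F, and [v] is a multiple of a rational zero. *)
Lemma frob_indep (v : 'I_3 -> L) : ~ v =1 (fun=> 0) -> cub kL v = 0 ->
  ~ cross v (fr q v) =1 (fun=> 0).
Proof.
move=> v0 kv /(cross_eq0 v0) [s sE].
have [i vi] := neq0_vec3 v0.
have fx j : exists a, v j / v i = f a.
  apply: finField_fixed; rewrite expr_div_n.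
  rewrite -[v j ^+ _]/(fr q v j) -[v i ^+ _]/(fr q v i) !sE.
  have s0 : s != 0.
    apply/eqP => s0; have := sE i; rewrite s0 mul0r /fr => /eqP.
    by rewrite expf_eq0 (negPf vi) andbF.
  by field; rewrite vi s0.
have [a aE] := fin_all_exists fx.
by apply: (@rational_not_zero v a (v i)) => // j; rewrite -aE mulrCA divff // mulr1.
Qed.

Lemma fr_neq0 (v : 'I_3 -> L) : ~ v =1 (fun=> 0) -> ~ fr q v =1 (fun=> 0).
Proof.
move=> v0 h; apply: v0 => i; apply/eqP; have /eqP := h i.
by rewrite /fr expf_eq0 => /andP [].
Qed.

(* Two consecutive Frobenius images cannot coincide projectively, as their common
   value would be a rational zero. *)
Lemma fr2_not_fr (v : 'I_3 -> L) s : ~ v =1 (fun=> 0) -> cub kL v = 0 ->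
  ~ fr (q ^ 2) v =1 (fun i => s * fr q v i).
Proof.
move=> v0 kv E.
apply: (@frob_indep (fr q v)); first exact: fr_neq0.
  by rewrite cub_fr kv expr0n; case: eqP => // q0; have := finNzRing_gt1 F; rewrite q0.
have E' i : fr q (fr q v) i = s * fr q v i by rewrite fr_fr E.
by move: E' => E'; apply: ord3P; rewrite /cross /vec3 /= !E'; ring.
Qed.

End PointsOverClosure.

(** The two coefficients of [third_point] make the mixed terms cancel identically in [v], so the
    formula also applies to a deformation v + X w. *)
Lemma cub_third_point (S : comNzRingType) (k : nat -> S) q v :
  cub k (third_point k q v) =
  pol k (fr q v) v ^+ 3 * cub k v - pol k v (fr q v) ^+ 3 * cub k (fr q v).
Proof. by rewrite cub_comb; ring. Qed.

Lemma exists_orthogonal (K : fieldType) (n : 'I_3 -> K) :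
  exists2 z, ~ z =1 (fun=> 0) & dot n z = 0.
Proof.
have [n0|n0] := eqVneq (n o0) 0.
  exists (vec3 1 0 0); last by rewrite /dot /vec3 /= n0; ring.
  by move=> /(_ o0) /eqP; rewrite /vec3 /= oner_eq0.
exists (vec3 (- n o1) (n o0) 0); last by rewrite /dot /vec3 /=; ring.
by move=> /(_ o1) /eqP; rewrite /vec3 /= (negPf n0).
Qed.

Section RationalLine.
Variables (F : finFieldType) (k : nat -> F).
Hypothesis no_point : forall a, cub k a = 0 -> a =1 fun=> 0.
Local Notation q := #|F|.
Variables (L : fieldType) (f : {rmorphism F -> L}).
Local Notation kL := (f \o k).
Variables (n : 'I_3 -> F) (v : 'I_3 -> L).
Hypothesis n0 : ~ n =1 fun=> 0.
Hypothesis v0 : ~ v =1 fun=> 0.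
Hypothesis kv : cub kL v = 0.
Hypothesis nv : dot (f \o n) v = 0.

Lemma finField_card_eq0 : (#|F| == 0)%N = false.
Proof. by apply/negbTE; rewrite -lt0n (ltn_trans _ (finNzRing_gt1 F)). Qed.

Lemma line_spanned (z : 'I_3 -> L) : dot (f \o n) z = 0 ->
  exists s t, z =1 (fun i => s * v i + t * fr q v i).
Proof.
move=> nz; apply: (@indep_span _ (f \o n)) => //.
- by move=> h; apply: n0 => i; apply: (fmorph_inj f); rewrite rmorph0 -(h i).
- by rewrite dot_fr nv expr0n finField_card_eq0.
- exact: (frob_indep no_point v0 kv).
Qed.

Lemma cub_frob_eq0 : cub kL (fr q v) = 0.
Proof. by rewrite cub_fr kv expr0n finField_card_eq0. Qed.

(** A rational line contains a rational point, which would be a rational zero. *)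
Lemma line_not_in_cubic : ~ (pol kL v (fr q v) = 0 /\ pol kL (fr q v) v = 0).
Proof.
move=> [b0 a0]; have [z z0 nz] := exists_orthogonal n.
have [|s [t E]] := @line_spanned (f \o z).
  by rewrite /dot /= -!rmorphM -!rmorphD -[X in f X]/(dot n z) nz rmorph0.
apply: z0; apply: no_point; apply: (fmorph_inj f); rewrite rmorph0 rmorph_cub.
rewrite (eq_cub (frefl kL) E) cub_comb kv cub_frob_eq0 b0 a0; ring.
Qed.

(** The line, being rational, contains a, b and c. With c = s a + t b the cubic reads s t (s be + t
    al) = 0, and neither s nor t can vanish. *)
Lemma line_third_point : pol kL v (fr q v) != 0 /\
  exists s, fr (q ^ 2) v =1 (fun i => s * third_point kL q v i).
Proof.
set b := fr q v; set al := pol kL b v; set be := pol kL v b.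
have cE : fr q b =1 fr (q ^ 2) v by apply: fr_fr.
have nc : dot (f \o n) (fr (q ^ 2) v) = 0.
  have nb : dot (f \o n) b = 0 by rewrite dot_fr nv expr0n finField_card_eq0.
  have nfb : dot (f \o n) (fr q b) = 0.
    by rewrite dot_fr nb expr0n finField_card_eq0.
  by rewrite -[RHS]nfb /dot !cE.
have [s [t E]] := line_spanned nc.
have kc : cub kL (fun i => s * v i + t * b i) = 0.
  rewrite -(eq_cub (frefl kL) E) -(eq_cub (frefl kL) cE) cub_fr cub_frob_eq0 expr0n.
  by rewrite finField_card_eq0.
(* If c = s a, Frobenius exchanges a and b up to scalars and so fixes the third point [w] up to a
   scalar. As there is no rational zero, [w] = 0, so both its coefficients vanish and the line lies
   in the cubic. *)
have t0 : t != 0.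
  apply/eqP => t0; have {}E i : fr (q ^ 2) v i = s * v i.
    by rewrite E t0 mul0r addr0.
  pose w := third_point kL q v.
  have kw : cub kL w = 0 by rewrite cub_third_point kv cub_frob_eq0; ring.
  have alq : al ^+ q = s ^+ 2 * be.
    rewrite -pol_fr (@eq_pol _ kL kL _ (fun i => s * v i) _ b) // ?polZl // => i.
    by rewrite cE E.
  have beq : be ^+ q = s * al.
    rewrite -pol_fr (@eq_pol _ kL kL _ b _ (fun i => s * v i)) // ?polZr // => i.
    by rewrite cE E.
  have frw i : fr q w i = (- s ^+ 2) * w i.
    have -> : fr q w i = al ^+ q * b i - be ^+ q * fr (q ^ 2) v i.
      rewrite -cE /w /third_point -/b -/al -/be /fr.
      rewrite -[LHS]/(frobq f (al * v i + - be * b i)) rmorphD rmorphM mulNr.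
      by rewrite rmorphN rmorphM.
    by rewrite alq beq E /w /third_point -/b -/al -/be; ring.
  have w0 : w =1 (fun=> 0).
    have [//|[i wi]] := vec3_eq0_or w; exfalso.
    apply: (@frob_indep _ _ no_point _ f w) => //.
      by move=> h; rewrite h eqxx in wi.
    by apply: ord3P; rewrite /cross /vec3 /= !frw; ring.
  have [j cj] := neq0_vec3 (frob_indep no_point v0 kv).
  apply: line_not_in_cubic; split; apply: (mulIf cj); rewrite mul0r.
    transitivity (cross w v j).
      by rewrite /w /third_point; move: j {cj}; apply: ord3P;
        rewrite /cross /vec3 /=; ring.
    by move: j {cj}; apply: ord3P; rewrite /cross /vec3 /= !w0; ring.
  transitivity (cross w b j).
    by rewrite /w /third_point -/b -/al -/be; move: j {cj}; apply: ord3P;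
      rewrite /cross /vec3 /=; ring.
  by move: j {cj}; apply: ord3P; rewrite /cross /vec3 /= !w0; ring.
have s0 : s != 0.
  apply/eqP => s0; apply: (fr2_not_fr no_point v0 kv (s := t)) => i.
  by rewrite E s0 mul0r add0r.
have st : s * be + t * al = 0.
  apply: (mulfI s0); apply: (mulfI t0); rewrite !mulr0 -[RHS]kc cub_comb kv cub_frob_eq0.
  by rewrite -/al -/be; ring.
have be0 : be != 0.
  apply/eqP => be0; apply: line_not_in_cubic; split=> //.
  by apply: (mulfI t0); rewrite mulr0 -[RHS]st -/be be0 mulr0 add0r.
split=> //; exists (- t / be) => i.
rewrite E /third_point -/b -/al -/be; apply: (mulIf be0).
transitivity (s * be * v i + t * b i * be); first by ring.
have -> : s * be = - (t * al) by apply/eqP; rewrite -addr_eq0 st.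
by field.
Qed.

(** The tangent at [v] misses b, so it differs from the given line and has a direction leaving that
    line. *)
Lemma line_tangent : exists w, pol kL v w = 0 /\ dot (f \o n) w = 1.
Proof.
have [be0 _] := line_third_point.
have [i ni] := neq0_vec3 n0.
have fni : f (n i) != 0 by rewrite fmorph_eq0.
pose e j := (f (n i))^-1 * basis3 L i j.
have ne : dot (f \o n) e = 1.
  transitivity ((f (n i))^-1 * dot (f \o n) (basis3 L i)); first by rewrite /dot /e; ring.
  by rewrite dot_basis3 /= mulVf.
exists (fun j => 1 * e j + (- (pol kL v e / pol kL v (fr q v))) * fr q v j); split.
  by rewrite pol_comb mulNr divfK // mul1r subrr.
have nb : dot (f \o n) (fr q v) = 0 by rewrite dot_fr nv expr0n finField_card_eq0.
transitivity (dot (f \o n) e - pol kL v e / pol kL v (fr q v) * dot (f \o n) (fr q v)).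
  by rewrite /dot; ring.
by rewrite ne nb mulr0 subr0.
Qed.

(** Taylor expansion combined with Euler's relation. If [x] and x + t y satisfy the cubic modulo
    t^2, then modulo t^2 the tangent line at x + t y passes through [x]. *)
Lemma pol_first_order (S : comNzRingType) (kS : nat -> S) (x y : 'I_3 -> S) t :
  pol kS (fun i => x i + t * y i) x =
  cub kS x + cub kS (fun i => x i + t * y i) *+ 2
  - t ^+ 2 * (pol kS y x + t * cub kS y *+ 2).
Proof. by rewrite /cub /pol /grad /dot /vec3 /=; ring. Qed.

(* The point of tangency moves along the cubic, so to first order the tangent line at
   the third point keeps passing through the fixed point [fr (q ^ 2) v]. *)
Lemma tangency_double (w : 'I_3 -> L) : pol kL v w = 0 ->
  exists r : {poly L},
    tangency (polyC \o kL) q (fun i => (v i)%:P + 'X * (w i)%:P) = 'X ^+ 2 * r.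
Proof.
move=> vw; pose C : {rmorphism L -> {poly L}} := @polyC L; pose kP := C \o kL.
pose vT i : {poly L} := (v i)%:P + 'X * (w i)%:P.
have [_ [s sE]] := line_third_point.
have q2 : (2 <= q)%N := finNzRing_gt1 F.
pose g : {rmorphism F -> {poly L}} := @polyC L \o f.
(* The arc v + X w follows the cubic to first order because w is tangent at v. *)
have kvT : cub kP vT = 'X ^+ 2 * (C (pol kL w v) + 'X * C (cub kL w)).
  rewrite (@eq_cub _ kP kP _ (fun i => 1 * C (v i) + 'X * C (w i))) // => [|i];
    last by rewrite mul1r.
  have rc u : cub kP (C \o u) = C (cub kL u) by rewrite (rmorph_cub C).
  have rp u u' : pol kP (C \o u) (C \o u') = C (pol kL u u') by rewrite (rmorph_pol C).
  rewrite (cub_comb kP (C \o v) (C \o w)) !rc !rp kv vw rmorph0; ring.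
have phi2 : exists r, cub kP (third_point kP q vT) = 'X ^+ 2 * r.
  rewrite cub_third_point.
  have -> : cub kP (fr q vT) = cub kP vT ^+ q by apply: (cub_fr g).
  have -> : cub kP vT ^+ q = cub kP vT * cub kP vT ^+ q.-1.
    by rewrite -exprS prednK // ltnW.
  rewrite kvT; set K := C _ + _; set A := pol _ _ _; set B := pol _ _ _.
  by exists (A ^+ 3 * K - B ^+ 3 * K * ('X ^+ 2 * K) ^+ q.-1); ring.
have dX (p : {poly L}) : p.[0] = 0 -> exists r, p = 'X * r.
  move=> /rootP /factor_theorem [r ->]; exists r.
  by rewrite polyC0 subr0 mulrC.
pose phi0 := third_point kL q v.
have /fin_all_exists [psi psiE] : forall i, exists r,
    third_point kP q vT i = C (phi0 i) + 'X * r.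
  move=> i; have [|r rE] := dX (third_point kP q vT i - C (phi0 i)).
    rewrite hornerD hornerN hornerC; apply/eqP; rewrite subr_eq0; apply/eqP.
    pose h : {rmorphism {poly L} -> L} := horner_eval 0.
    rewrite -[LHS]/(h _) /third_point !rmorphD !rmorphM rmorphN !rmorph_pol.
    have hv j : h (vT j) = v j by rewrite /h /= /horner_eval !hornerE.
    have hk : h \o kP =1 kL by move=> j; rewrite /h /= /horner_eval hornerC.
    have hfr : h \o fr q vT =1 fr q v by move=> j; rewrite /= /fr rmorphXn hv.
    have hvT : h \o vT =1 v by [].
    rewrite (eq_pol hk hfr hvT) (eq_pol hk hvT hfr) hv.
    by rewrite -[h (fr q vT i)]/((h \o fr q vT) i) hfr.
  by exists r; rewrite -rE addrC subrK.
have kphi0 : cub kL phi0 = 0 by rewrite cub_third_point kv cub_frob_eq0; ring.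
(* Frobenius keeps c stationary: w enters it only through X^(q^2), hence not at all modulo X^2. *)
have [r2 r2E] : exists r : 'I_3 -> {poly L},
    forall i, fr (q ^ 2) vT i = C (fr (q ^ 2) v i) + 'X ^+ 2 * r i.
  exists (fun i => 'X ^+ (q ^ 2 - 2) * C (w i) ^+ (q ^ 2)) => i.
  rewrite -!fr_fr /fr (finField_Frobenius g) (finField_Frobenius g) !exprMn.
  have q22 : (2 <= q ^ 2)%N by rewrite (leq_trans q2) // -{1}(expn1 q) leq_pexp2l // ltnW.
  by rewrite !rmorphXn -!exprM mulnn mulrA -exprD subnKC.
have [r rE] := phi2.
have phiE i : third_point kP q vT i = C (phi0 i) + 'X * psi i := psiE i.
have hk0 : cub kP (C \o phi0) = 0 by rewrite -(rmorph_cub C) kphi0 rmorph0.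
have E1 : pol kP (third_point kP q vT) (C \o phi0) =
    'X ^+ 2 * (r *+ 2 - (pol kP psi (C \o phi0) + 'X * cub kP psi *+ 2)).
  rewrite (eq_pol (frefl kP) phiE (frefl (C \o phi0))) pol_first_order hk0.
  by rewrite -(eq_cub (frefl kP) phiE) rE; ring.
exists (C s * (r *+ 2 - (pol kP psi (C \o phi0) + 'X * cub kP psi *+ 2))
    + pol kP (third_point kP q vT) r2).
rewrite /tangency -/kP -/vT.
have cE i : fr (q ^ 2) vT i = C s * (C \o phi0) i + 'X ^+ 2 * r2 i.
  by rewrite r2E sE /= /C polyCM.
rewrite (eq_pol (frefl kP) (frefl (third_point kP q vT)) cE) pol_comb E1; ring.
Qed.

End RationalLine.

(** * Reduction modulo a rational line and the cubic *)

Lemma line_coordinates (F : fieldType) (n : 'I_3 -> F) : ~ n =1 (fun=> 0) ->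
  exists r s e sg ta : 'I_3 -> F,
  [/\ forall i j : 'I_3, (i == j)%:R = r i * sg j + s i * ta j + e i * n j,
      dot ta r = 0 /\ dot ta s = 1, dot sg r = 1 /\ dot sg s = 0 &
      dot n r = 0 /\ dot n s = 0].
Proof.
move=> /neq0_vec3 [i]; move: i; apply: ord3P => ni.
- exists (vec3 (- n o1 / n o0) 1 0), (vec3 (- n o2 / n o0) 0 1), (vec3 (n o0)^-1 0 0).
  exists (vec3 0 1 0), (vec3 0 0 1).
  split; [|by split; rewrite /dot /vec3 /=; ring|by split; rewrite /dot /vec3 /=; ring
    |by split; rewrite /dot /vec3 /=; field].
  by apply: ord3P; apply: ord3P; rewrite /vec3 /=; field.
- exists (vec3 1 (- n o0 / n o1) 0), (vec3 0 (- n o2 / n o1) 1), (vec3 0 (n o1)^-1 0).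
  exists (vec3 1 0 0), (vec3 0 0 1).
  split; [|by split; rewrite /dot /vec3 /=; ring|by split; rewrite /dot /vec3 /=; ring
    |by split; rewrite /dot /vec3 /=; field].
  by apply: ord3P; apply: ord3P; rewrite /vec3 /=; field.
- exists (vec3 1 0 (- n o0 / n o2)), (vec3 0 1 (- n o1 / n o2)), (vec3 0 0 (n o2)^-1).
  exists (vec3 1 0 0), (vec3 0 1 0).
  split; [|by split; rewrite /dot /vec3 /=; ring|by split; rewrite /dot /vec3 /=; ring
    |by split; rewrite /dot /vec3 /=; field].
  by apply: ord3P; apply: ord3P; rewrite /vec3 /=; field.
Qed.

Definition linm (F : fieldType) (c : 'I_3 -> F) : {mpoly F[3]} :=
  dot (fun i => (c i)%:MP) (@Xv F).

Lemma linm_form (F : fieldType) (c : 'I_3 -> F) : is_form predT 1 (linm c).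
Proof.
by rewrite /linm /dot /Xv /=; do 2?apply: form_D; apply: form_scale; apply: form_var.
Qed.

Lemma ev_linm (F : fieldType) (S : comNzRingType) (f : {rmorphism F -> S}) v c :
  ev f v (linm c) = dot (f \o c) v.
Proof. by rewrite /linm /dot !rmorphD !rmorphM !evC !evX. Qed.

(* Normal forms of degree [d] modulo a line and the cubic, the latter being of degree 3
   in [S]. *)
Definition nf (R : comNzRingType) (S T : R) (d : nat) (r0 r1 r2 : R) : R :=
  match d with
  | 0 => r0
  | 1 => r0 * T + r1 * S
  | e.+2 => (r0 * T ^+ 2 + r1 * (S * T) + r2 * S ^+ 2) * T ^+ e
  end.

Lemma rmorph_nf (R R' : comNzRingType) (h : {rmorphism R -> R'}) S T d r0 r1 r2 :
  h (nf S T d r0 r1 r2) = nf (h S) (h T) d (h r0) (h r1) (h r2).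
Proof. by case: d => [|[|d]] /=; rewrite ?(rmorphD, rmorphM, rmorphXn). Qed.

Section LineReduction.
Variables (F : fieldType) (k : nat -> F) (n r s e sg ta : 'I_3 -> F).
Hypothesis coordE : forall i j : 'I_3, (i == j)%:R = r i * sg j + s i * ta j + e i * n j.
Hypothesis kr : cub k r != 0.
Local Notation R := {mpoly F[3]}.
Local Notation S := (linm sg).
Local Notation T := (linm ta).
Local Notation l := (linm n).
Local Notation nfm d r0 r1 r2 := (nf S T d r0%:MP_[3] r1%:MP_[3] r2%:MP_[3]).

Lemma line_var i : 'X_i = (r i)%:MP * S + (s i)%:MP * T + (e i)%:MP * l :> R.
Proof.
transitivity (\sum_(j < 3) (i == j)%:R%:MP * 'X_j : R).
  rewrite (bigD1 i) //= eqxx mpolyC1 mul1r big1 ?addr0 // => j ji.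
  by rewrite eq_sym (negPf ji) mpolyC0 mul0r.
rewrite big_ord3 /= !coordE !mpolyCD !mpolyCM /linm /dot /Xv; ring.
Qed.

Lemma nfm_form d r0 r1 r2 : is_form predT d (nfm d r0 r1 r2).
Proof.
have fS := linm_form sg; have fT := linm_form ta.
case: d => [|[|d]] /=; first exact: form_C.
  by apply: form_D; apply: form_scale.
rewrite -[d.+2]/(2 + d)%N; apply: form_mul; last exact: form_pow1.
have fT2 : is_form predT 2 (T ^+ 2) := form_exp 2 fT.
have fS2 : is_form predT 2 (S ^+ 2) := form_exp 2 fS.
have fST : is_form predT 2 (S * T) := form_mul fS fT.
by do 2?apply: form_D; apply: form_scale.
Qed.

Lemma nfD d (r0 r1 r2 r0' r1' r2' : F) :
  nfm d r0 r1 r2 + nfm d r0' r1' r2' = nfm d (r0 + r0') (r1 + r1') (r2 + r2').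
Proof. by case: d => [|[|d]] /=; rewrite !mpolyCD; ring. Qed.

Lemma cubm_on_line : exists Q p0 p1 p2 p3, [/\ is_form predT 2 Q, p3 != 0 &
  cubm k = p3%:MP * S ^+ 3 + p2%:MP * (S ^+ 2 * T) + p1%:MP * (S * T ^+ 2)
    + p0%:MP * T ^+ 3 + Q * l].
Proof.
pose C (v : 'I_3 -> F) : 'I_3 -> R := fun i => (v i)%:MP.
have XE i : @Xv F i = S * C r i + T * C s i + l * C e i.
  by rewrite /Xv line_var /C; ring.
have fS := linm_form sg; have fT := linm_form ta; have fl := linm_form n.
have f2 (H K : R) c : is_form predT 1 H -> is_form predT 1 K ->
    is_form predT 2 (c%:MP * (H * K)).
  by move=> fH fK; apply: form_scale; apply: form_mul fH fK.
exists ((pol k r e)%:MP * (S * S) + (tri k r s e)%:MP * (S * T)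
  + (pol k e r)%:MP * (S * l) + (pol k s e)%:MP * (T * T)
  + (pol k e s)%:MP * (T * l) + (cub k e)%:MP * (l * l)).
exists (cub k s), (pol k s r), (pol k r s), (cub k r); split=> //.
  by do 5?apply: form_D; apply: f2.
rewrite /cubm (eq_cub (frefl (kC k)) XE) cub_comb3.
pose m := @mpolyC 3 F.
by rewrite -!(rmorph_cub m) -!(rmorph_pol m) -(rmorph_tri m); ring.
Qed.

(** Modulo the line, multiplying a normal form by a variable leaves the normal shape only through a
    term S^3 T^d. The coefficient of S^3 in the cubic is [cub k r], which is not 0, so the cubic
    removes this term. *)
Lemma line_reduction d H : is_form predT d H -> exists A B r0 r1 r2,
  zform predT d 1 B /\ H = A * cubm k + B * l + nfm d r0 r1 r2.
Proof.
elim=> {d H} [d|c|d H K _ [A [B [r0 [r1 [r2 [zB ->]]]]]] _ [A' [B' [r0' [r1' [r2' [zB' ->]]]]]]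
  |d i H _ _ [A [B [r0 [r1 [r2 [zB ->]]]]]]].
- exists 0, 0, 0, 0, 0; split; first exact: zform0.
  by case: d => [|[|d]] /=; rewrite !mpolyC0; ring.
- exists 0, 0, c, 0, 0; split; first exact: zform0.
  by rewrite /=; ring.
- exists (A + A'), (B + B'), (r0 + r0'), (r1 + r1'), (r2 + r2').
  by split; [exact: zformD | rewrite -nfD; ring].
have [Q [p0 [p1 [p2 [p3 [fQ p30 kE]]]]]] := cubm_on_line.
have fnf := nfm_form d r0 r1 r2.
have zB1 : zform predT d.+1 1 ('X_i * B + (e i)%:MP * nfm d r0 r1 r2).
  apply: zformD.
    rewrite mulrC; apply: (@zformM _ _ d 1 1) => //; last exact: form_var.
    by rewrite [(d + 1)%N]addn1.
  by rewrite /zform /= subn1; apply: form_scale.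
case: d zB fnf zB1 => [|[|d]] /= zB fnf zB1.
- exists ('X_i * A), ('X_i * B + (e i)%:MP * r0%:MP), (s i * r0), (r i * r0), 0.
  split=> //; transitivity ('X_i * A * cubm k + 'X_i * B * l
    + ((r i)%:MP * S + (s i)%:MP * T + (e i)%:MP * l) * r0%:MP).
    by rewrite -line_var; ring.
  by rewrite !mpolyCM; ring.
- exists ('X_i * A), ('X_i * B + (e i)%:MP * (r0%:MP * T + r1%:MP * S)),
    (s i * r0), (r i * r0 + s i * r1), (r i * r1).
  split=> //; transitivity ('X_i * A * cubm k + 'X_i * B * l
    + ((r i)%:MP * S + (s i)%:MP * T + (e i)%:MP * l) * (r0%:MP * T + r1%:MP * S)).
    by rewrite -line_var; ring.
  by rewrite expr0 mulr1 !mpolyCD !mpolyCM; ring.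
have [g gE] : exists g, r i * r2 = g * p3 by exists (r i * r2 / p3); rewrite divfK.
exists ('X_i * A + g%:MP * T ^+ d),
  ('X_i * B + (e i)%:MP * nfm d.+2 r0 r1 r2 - g%:MP * (Q * T ^+ d)),
  (s i * r0 - g * p0), (r i * r0 + s i * r1 - g * p1),
  (r i * r1 + s i * r2 - g * p2); split.
  apply: zform_diff => //; rewrite /zform /= subn1 /=; apply: form_scale.
  rewrite -[d.+2]/(2 + d)%N; apply: form_mul => //.
  exact: form_pow1 (linm_form ta).
transitivity ('X_i * A * cubm k + 'X_i * B * l
  + ((r i)%:MP * S + (s i)%:MP * T + (e i)%:MP * l) * nfm d.+2 r0 r1 r2).
  by rewrite -line_var /=; ring.
rewrite /=; transitivity ('X_i * (A * cubm k) + 'X_i * (B * l)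
  + (e i)%:MP * l * ((r0%:MP * T ^+ 2 + r1%:MP * (S * T) + r2%:MP * S ^+ 2) * T ^+ d)
  + (g%:MP * (cubm k - p2%:MP * (S ^+ 2 * T) -
  p1%:MP * (S * T ^+ 2) - p0%:MP * T ^+ 3 - Q * l)
  + (r i)%:MP * (r0%:MP * T ^+ 2 * S + r1%:MP * (S ^+ 2 * T))
  + (s i)%:MP * T * (r0%:MP * T ^+ 2 + r1%:MP * (S * T) + r2%:MP * S ^+ 2)) * T ^+ d);
  last by rewrite !(mpolyCD, mpolyCB, mpolyCM) [_ ^+ d.+1]exprS; ring.
have gP : (r i)%:MP * r2%:MP = g%:MP * p3%:MP :> R by rewrite -!mpolyCM gE.
have -> : g%:MP * (cubm k - p2%:MP * (S ^+ 2 * T) -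
    p1%:MP * (S * T ^+ 2) - p0%:MP * T ^+ 3 - Q * l)
    = (r i)%:MP * r2%:MP * S ^+ 3 by rewrite gP kE; ring.
by ring.
Qed.

End LineReduction.

Section LineCriterion.
Variables (F : finFieldType) (k : nat -> F).
Hypothesis no_point : forall a, cub k a = 0 -> a =1 fun=> 0.
Variables (L : fieldType) (f : {rmorphism F -> L}).
Local Notation kL := (f \o k).

Lemma cub_neq0 a : ~ a =1 (fun=> 0) -> cub k a != 0.
Proof. by move=> a0; apply/eqP => /no_point. Qed.

(* The cubic has no zero on the rational line through [a] and [b], so [th] has degree 3
   over [F]. *)
Lemma cubic_root_indep (a b : 'I_3 -> F) (th : L) (c0 c1 c2 : F) :
  (forall x, ~ (fun i => x * a i + 1 * b i) =1 (fun=> 0)) -> ~ a =1 (fun=> 0) ->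
  cub kL (fun i => th * f (a i) + 1 * f (b i)) = 0 ->
  f c0 + f c1 * th + f c2 * th ^+ 2 = 0 -> [/\ c0 = 0, c1 = 0 & c2 = 0].
Proof.
move=> ab a0 kth rth.
pose p := Poly [:: cub k b; pol k b a; pol k a b; cub k a].
have sp : size p = 4 by rewrite (@PolyK _ 0) //= cub_neq0.
pose g := Poly [:: c0; c1; c2].
have pE (K : fieldType) (h : {rmorphism F -> K}) x : (map_poly h p).[x] =
    cub (h \o k) (fun i => x * h (a i) + 1 * h (b i)).
  rewrite (cub_comb _ (h \o a) (h \o b)) -!rmorph_cub -!rmorph_pol.
  rewrite (@horner_coef_wide _ 4) ?size_map_poly ?sp //.
  by rewrite !big_ord_recl big_ord0 !coef_map !coef_Poly /=; ring.
have irr : irreducible_poly p.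
  apply: cubic_irreducible; first by rewrite sp.
  move=> x; apply/rootP => px; apply: (ab x); apply: no_point.
  have := pE F idfun x; rewrite map_poly_id // px => h.
  by rewrite [RHS]h; apply: eq_cub.
have g0 : g = 0.
  apply/eqP/negPn/negP => g0.
  have sg : (size g <= 3)%N := size_Poly _.
  have rg : root (map_poly f (gcdp p g)) th.
    rewrite gcdp_map root_gcd; apply/andP; split; apply/rootP; first by rewrite pE.
    rewrite (@horner_coef_wide _ 3) ?size_map_poly //.
    by rewrite big_ord3 !coef_map !coef_Poly /= -[RHS]rth; ring.
  have s1 : size (gcdp p g) != 1.
    apply/eqP => /eqP/size_poly1P [c c_0 gc].
    by move: rg; rewrite gc map_polyC rootC fmorph_eq0 (negPf c_0).
  have /eqp_size := irr.2 _ s1 (dvdp_gcdl _ _); rewrite sp => s4.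
  have := dvdp_leq g0 (dvdp_gcdr p g); rewrite s4 => s4'.
  by have := leq_trans s4' sg.
have E i : g`_i = 0 by rewrite g0 coef0.
by split; [have := E 0%N | have := E 1%N | have := E 2]; rewrite coef_Poly.
Qed.

Variables (n : 'I_3 -> F) (v : 'I_3 -> L).
Hypothesis n0 : ~ n =1 fun=> 0.
Hypothesis v0 : ~ v =1 fun=> 0.
Hypothesis kv : cub kL v = 0.
Hypothesis nv : dot (f \o n) v = 0.

(** On the line, [v] has a parameter th = x / y of degree 3 over F. The normal form at [v] is, up to
    a power of y, a polynomial of degree at most 2 in th over F, so it vanishes only if its
    coefficients do. *)
Lemma form_vanishing_on_line d H : is_form predT d H -> ev f v H = 0 ->
  exists A B, zform predT d 1 B /\ H = A * cubm k + B * linm n.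
Proof.
move=> fH Hv.
have [r [s [e [sg [ta [cE [tr ts] [sr ss] _]]]]]] := line_coordinates n0.
have r0 : ~ r =1 (fun=> 0).
  by move=> h; move: sr; rewrite /dot !h !mulr0 !addr0 => /eqP; rewrite eq_sym oner_eq0.
have rs x : ~ (fun i => x * r i + 1 * s i) =1 (fun=> 0).
  move=> h; have h' i : x * r i + 1 * s i = 0 := h i.
  have : x * dot ta r + dot ta s = 0.
    transitivity (dot ta (fun i => x * r i + 1 * s i)); first by rewrite /dot; ring.
    by rewrite /dot !h' !mulr0 !addr0.
  by rewrite tr ts mulr0 add0r => /eqP; rewrite oner_eq0.
have [A [B [r0' [r1 [r2 [zB HE]]]]]] := line_reduction cE (cub_neq0 r0) fH.
exists A, B; split=> //.
pose x := dot (f \o sg) v; pose y := dot (f \o ta) v.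
have vE i : v i = x * f (r i) + y * f (s i).
  rewrite -[v i](evX f v) (line_var cE) !rmorphD !rmorphM !evC !ev_linm nv.
  by rewrite mulr0 addr0 ![_ * f _]mulrC.
have y0 : y != 0.
  apply/eqP => y0; apply: (rational_not_zero no_point v0 kv (a := r) (s := x)) => i.
  by rewrite vE y0 mul0r addr0.
have Hnf : nf x y d (f r0') (f r1) (f r2) = 0.
  move: Hv; rewrite HE !rmorphD 2!rmorphM ev_cubm ev_linm kv nv !mulr0 !add0r.
  by rewrite rmorph_nf !evC !ev_linm.
have kth : cub kL (fun i => x / y * f (r i) + 1 * f (s i)) = 0.
  apply: (mulfI (expf_neq0 3 y0)); rewrite mulr0 -cubZ -[RHS]kv.
  by apply: eq_cub => // i; rewrite vE; field.
suff nf0 : nf (linm sg) (linm ta) d r0'%:MP_[3] r1%:MP_[3] r2%:MP_[3] = 0.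
  by rewrite HE nf0 addr0.
have indep := cubic_root_indep rs r0 kth.
case: d Hnf {fH zB HE} => [|[|d]] /= Hnf.
- by have [|-> _ _] := indep r0' 0 0; rewrite ?rmorph0 ?Hnf ?mpolyC0 //; ring.
- have [|-> -> _] := indep r0' r1 0.
  + apply: (mulIf y0); rewrite mul0r -[RHS]Hnf rmorph0; by field.
  + by rewrite mpolyC0; ring.
- have [|-> -> ->] := indep r0' r1 r2.
  + apply: (mulIf (expf_neq0 d.+2 y0)); rewrite mul0r -[RHS]Hnf.
    by rewrite -[d.+2]/(2 + d)%N exprD; field.
  + by rewrite mpolyC0; ring.
Qed.

End LineCriterion.

Lemma rmorph_ev (F : fieldType) (S S' : comNzRingType) (f : {rmorphism F -> S})
  (h : {rmorphism S -> S'}) v H : h (ev f v H) = ev (h \o f) (h \o v) H.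
Proof.
rewrite /ev /= /mmap rmorph_sum; apply: eq_bigr => m _.
rewrite rmorphM; congr (_ * _); rewrite /mmap1 rmorph_prod.
by apply: eq_bigr => i _; rewrite rmorphXn.
Qed.

Lemma eq_ev (F : fieldType) (S : comNzRingType) (f f' : {rmorphism F -> S}) v v' :
  f =1 f' -> v =1 v' -> ev f v =1 ev f' v'.
Proof.
move=> ef eg H; rewrite /ev /= /mmap; apply: eq_bigr => m _.
by rewrite ef; congr (_ * _); rewrite /mmap1; apply: eq_bigr => i _; rewrite eg.
Qed.

(** * Dividing by all rational lines *)

Section Lines.
Variables (F : finFieldType) (k : nat -> F).
Hypothesis no_point : forall a, cub k a = 0 -> a =1 fun=> 0.
Variables (L : closedFieldType) (f : {rmorphism F -> L}).
Local Notation kL := (f \o k).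
Local Notation q := #|F|.

Lemma line_root (n : 'I_3 -> F) : ~ n =1 (fun=> 0) -> exists v : 'I_3 -> L,
  [/\ ~ v =1 (fun=> 0), cub kL v = 0 & dot (f \o n) v = 0].
Proof.
move=> n0.
have [r [s [e [sg [ta [_ [tr ts] [sr _] [nr ns]]]]]]] := line_coordinates n0.
have r0 : ~ r =1 (fun=> 0).
  by move=> h; move: sr; rewrite /dot !h !mulr0 !addr0 => /eqP; rewrite eq_sym oner_eq0.
pose p := Poly [:: cub kL (f \o s); pol kL (f \o s) (f \o r); pol kL (f \o r) (f \o s);
  cub kL (f \o r)].
have kr : cub kL (f \o r) != 0 by rewrite -rmorph_cub fmorph_eq0 cub_neq0.
have sp : size p = 4 by rewrite (@PolyK _ 0).
have /closed_rootP [x /rootP px] : size p != 1 by rewrite sp.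
pose v := fun i => x * (f \o r) i + 1 * (f \o s) i.
have dv c : dot (f \o c) v = x * f (dot c r) + f (dot c s).
  by rewrite /dot /v /=; ring.
exists v; split.
- move=> h; have := dv ta; rewrite tr ts rmorph0 rmorph1 mulr0 add0r /dot !h.
  by rewrite !mulr0 !addr0 => /eqP; rewrite eq_sym oner_eq0.
- rewrite cub_comb -[RHS]px (@horner_coef_wide _ 4) ?sp //.
  by rewrite !big_ord_recl big_ord0 !coef_Poly /=; ring.
- by rewrite dv nr ns rmorph0; ring.
Qed.

Lemma zform_vanishing_on_line n v D s H : ~ n =1 (fun=> 0) -> ~ v =1 (fun=> 0) ->
  cub kL v = 0 -> dot (f \o n) v = 0 -> zform predT D s H -> ev f v H = 0 ->
  exists A B, zform predT D s.+1 B /\ H = A * cubm k + B * linm n.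
Proof.
move=> n0 v0 kv nv; rewrite {1}/zform; case: ifP => [sD fH Hv|_ -> _]; last first.
  by exists 0, 0; split; [exact: zform0 | rewrite !mul0r addr0].
have [A [B [zB E]]] := form_vanishing_on_line no_point n0 v0 kv nv fH Hv.
by exists A, B; split=> //; move: zB; rewrite /zform subn_gt0 -subnDA addn1.
Qed.

(** Two distinct rational lines meet in the rational point [cross n m], which is not on the
    cubic. *)
Lemma line_avoids (n m : 'I_3 -> F) v : ~ cross n m =1 (fun=> 0) ->
  ~ v =1 (fun=> 0) -> cub kL v = 0 -> dot (f \o n) v = 0 -> dot (f \o m) v != 0.
Proof.
move=> nm v0 kv nv; apply/eqP => mv.
have z0 : ~ (f \o cross n m) =1 (fun=> 0).
  by move=> h; apply: nm => i; apply: (fmorph_inj f); rewrite rmorph0 -(h i).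
have [|s sE] := @cross_eq0 _ (f \o cross n m) v z0.
  move=> i; transitivity (dot (f \o n) v * (f \o m) i - dot (f \o m) v * (f \o n) i);
    last by rewrite nv mv !mul0r subr0.
  by move: i; apply: ord3P; rewrite /cross /dot /vec3 /=; ring.
exact: (rational_not_zero no_point v0 kv sE).
Qed.

(** Double vanishing is tested along the tangent arc v + X w, on which the equation of the line
    restricts to X itself. *)
Definition double_on_lines (G : {mpoly F[3]}) : Prop :=
  forall n v, ~ n =1 (fun=> 0) -> ~ v =1 (fun=> 0) -> cub kL v = 0 ->
  dot (f \o n) v = 0 -> ev f v G = 0 /\ exists w, [/\ pol kL v w = 0,
    dot (f \o n) w = 1 & exists r,
    ev (polyC \o f) (fun i => (v i)%:P + 'X * (w i)%:P) G = 'X ^+ 2 * r].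

(** Modulo the cubic, each new line divides the cofactor [B] twice, since the product over the
    earlier lines does not vanish at [v]. Once twice the number of lines exceeds [D], [zform] leaves
    only B = 0. *)
Lemma lines_divide (I : eqType) (N : I -> 'I_3 -> F) (D : nat) (G : {mpoly F[3]}) (s : seq I) :
  (forall i, ~ N i =1 fun=> 0) ->
  (forall i j, i != j -> ~ cross (N i) (N j) =1 fun=> 0) ->
  is_form predT D G -> double_on_lines G -> uniq s ->
  exists A B, zform predT D (size s).*2 B /\
    G = A * cubm k + B * (\prod_(i <- s) linm (N i)) ^+ 2.
Proof.
move=> N0 Nij fG dG; elim: s => [_|i s IHs /= /andP [ins us]].
  by exists 0, G; rewrite big_nil expr1n mulr1 mul0r add0r /zform subn0.
have [A [B [zB E]]] := IHs us; set Q := \prod_(j <- s) _ in E.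
have [v [v0 kv nv]] := line_root (@N0 i).
have Qv : ev f v Q != 0.
  rewrite /Q rmorph_prod big_seq; apply: (big_ind (fun x => x != 0)).
  - exact: oner_neq0.
  - by move=> x y; apply: mulf_neq0.
  move=> j js; rewrite /= ev_linm; apply: (@line_avoids (N i)) => //.
  by apply: Nij; apply: contraNneq ins => ->.
have [Gv [w [vw nw [t tE]]]] := dG _ _ (@N0 i) v0 kv nv.
have Bv : ev f v B = 0.
  apply: (mulIf (expf_neq0 2 Qv)); rewrite mul0r -[RHS]Gv E.
  rewrite rmorphD (rmorphM _ A) (rmorphM _ B) rmorphXn.
  by rewrite ev_cubm kv mulr0 add0r.
have [A1 [B1 [zB1 E1]]] := zform_vanishing_on_line (@N0 i) v0 kv nv zB Bv.
have B1v : ev f v B1 = 0.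
  pose C : {rmorphism L -> {poly L}} := @polyC L.
  pose g : {rmorphism F -> {poly L}} := C \o f.
  pose vT j : {poly L} := C (v j) + 'X * C (w j).
  have kvT : ev g vT (cubm k) = 'X ^+ 2 * (C (pol kL w v) + 'X * C (cub kL w)).
    rewrite ev_cubm (@eq_cub _ (C \o kL) (C \o kL) _ (fun i => 1 * C (v i) + 'X * C (w i))) //.
      rewrite (cub_comb _ (C \o v) (C \o w)) -!(rmorph_cub C) -!(rmorph_pol C) kv vw.
      by rewrite rmorph0; ring.
    by move=> j; rewrite mul1r.
  have nvT : ev g vT (linm (N i)) = 'X.
    rewrite ev_linm; transitivity (C (dot (f \o N i) v) + 'X * C (dot (f \o N i) w)).
      by rewrite /vT /g /dot /=; ring.
    by rewrite nv nw rmorph0 rmorph1 add0r mulr1.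
  have X0 : ('X : {poly L}) != 0 by rewrite polyX_eq0.
  (* Along the arc the cubic is O(X^2) and the line is X; cancelling one X from the double zero of G
     leaves another on the right, so B1 vanishes at v. *)
  have E2 : ev g vT B1 * ev g vT Q ^+ 2 =
      'X * (t - (ev g vT A + ev g vT A1 * ev g vT Q ^+ 2)
               * (C (pol kL w v) + 'X * C (cub kL w))).
    apply: (mulfI X0).
    have GE : ev g vT G = (ev g vT A + ev g vT A1 * ev g vT Q ^+ 2) * ev g vT (cubm k)
        + ev g vT B1 * ev g vT (linm (N i)) * ev g vT Q ^+ 2.
      by rewrite E E1; move: (cubm k) (linm (N i)) (ev g vT) (Q) => p l h Q'; ring.
    have {}tE : ev g vT G = 'X ^+ 2 * t by [].
    transitivity (ev g vT G - (ev g vT A + ev g vT A1 * ev g vT Q ^+ 2)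
      * ev g vT (cubm k)); first by rewrite GE nvT; ring.
    by rewrite tE kvT; ring.
  pose h0 : {rmorphism {poly L} -> L} := horner_eval 0.
  have hE H : h0 (ev g vT H) = ev f v H.
    rewrite rmorph_ev; apply: eq_ev => j; first by rewrite /h0 /= /horner_eval hornerC.
    by rewrite /h0 /vT /= /horner_eval !hornerE.
  have /(congr1 h0) := E2; rewrite (rmorphM _ (ev _ _ B1)) rmorphXn (rmorphM _ 'X) !hE.
  rewrite [h0 'X]/(horner_eval _ _) /horner_eval hornerX.
  by rewrite mul0r => /eqP; rewrite mulf_eq0 expf_eq0 (negPf Qv) orbF => /eqP.
have [A2 [B2 [zB2 E3]]] := zform_vanishing_on_line (@N0 i) v0 kv nv zB1 B1v.
exists (A + (A1 + A2 * linm (N i)) * Q ^+ 2), B2; split=> //.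
by rewrite big_cons -/Q E E1 E3; ring.
Qed.

Lemma ev_tangency (S : comNzRingType) (g : {rmorphism F -> S}) v :
  ev g v (tangency (kC k) q (@Xv F)) = tangency (g \o k) q v.
Proof.
have hk : ev g v \o kC k =1 g \o k by move=> i; apply: evC.
have hX : ev g v \o @Xv F =1 v by move=> i; apply: evX.
have hfr m : ev g v \o fr m (@Xv F) =1 fr m v by move=> i; rewrite /= rmorphXn evX.
rewrite /tangency rmorph_pol; apply: eq_pol => // i.
rewrite /= /third_point rmorphD !rmorphM rmorphN !rmorph_pol evX.
by rewrite (eq_pol hk (hfr q) hX) (eq_pol hk hX (hfr q)) rmorphXn evX.
Qed.

Lemma tangency_double_on_lines : double_on_lines (tangency (kC k) q (@Xv F)).
Proof.
move=> n v n0 v0 kv nv; split.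
  have [_ [s sE]] := line_third_point no_point n0 v0 kv nv.
  rewrite ev_tangency /tangency (eq_pol (frefl kL) (frefl _) sE) polZr pol_diag.
  rewrite cub_third_point kv cub_frob_eq0 //; by ring.
have [w [vw nw]] := line_tangent no_point n0 v0 kv nv.
exists w; split=> //; rewrite ev_tangency.
exact: (tangency_double no_point n0 v0 kv nv vw).
Qed.

(** One representative per rational line, its first non-zero coordinate being 1; the index type has
    1 + q + q^2 elements. *)
Definition proj_line (i : option (F + F * F)) : 'I_3 -> F :=
  match i with
  | None => vec3 0 0 1
  | Some (inl a) => vec3 0 1 a
  | Some (inr (a, b)) => vec3 1 a b
  end.

Lemma proj_line_neq0 i : ~ proj_line i =1 fun=> 0.
Proof.
by case: i => [[a|[a b]]|] h; [have := h o1|have := h o0|have := h o2];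
  rewrite /proj_line /vec3 /= => /eqP; rewrite oner_eq0.
Qed.

Lemma proj_line_indep i j : i != j -> ~ cross (proj_line i) (proj_line j) =1 fun=> 0.
Proof.
move=> ij h; move: (h o0) (h o1) (h o2) ij.
case: i {h} => [[a|[a b]]|]; case: j => [[c|[c d]]|] //=;
  rewrite /cross /vec3 /= !(mul0r, mulr0, mul1r, mulr1, subr0, sub0r) => h0 h1 h2.
- by move/eqP: h0; rewrite subr_eq0 => /eqP ->; rewrite eqxx.
- by move/eqP: h2; rewrite oppr_eq0 oner_eq0.
- by move/eqP: h0; rewrite oner_eq0.
- by move/eqP: h2; rewrite oner_eq0.
- move/eqP: h2; rewrite subr_eq0 => /eqP ->.
  by move/eqP: h1; rewrite subr_eq0 => /eqP ->; rewrite eqxx.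
- by move/eqP: h1; rewrite oppr_eq0 oner_eq0.
- by move/eqP: h0; rewrite oppr_eq0 oner_eq0.
- by move/eqP: h1; rewrite oner_eq0.
Qed.

Lemma tangency_form :
  is_form predT (2 * (2 * q + 2) + q ^ 2) (tangency (kC k) q (@Xv F)).
Proof.
have fX i : is_form predT 1 (@Xv F i) by apply: form_var.
have fX' m i : is_form predT m (fr m (@Xv F) i) by apply: form_pow1.
apply: pol_form => // i; rewrite /third_point mulNr; apply: form_diff.
  rewrite (_ : 2 * q + 2 = 2 * q + 1 + 1)%N; last by rewrite -addnA.
  by apply: form_mul => //; apply: pol_form.
rewrite (_ : 2 * q + 2 = 2 * 1 + q + q)%N; last by move: q; clear; lia.
by apply: form_mul => //; apply: pol_form.
Qed.

Lemma tangency_divisible : (2 < q)%N ->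
  exists A, tangency (kC k) q (@Xv F) = A * cubm k.
Proof.
move=> q3; have [A [B [zB ->]]] := lines_divide proj_line_neq0 proj_line_indep
  tangency_form tangency_double_on_lines (enum_uniq {: option (F + F * F)}).
exists A; move: zB; rewrite /zform -cardE card_option card_sum card_prod; case: ifP.
  (* The degree (q + 2)^2 against 2 (q^2 + q + 1): 25 < 26 at q = 3, but 16 > 14 at q = 2. *)
  by move=> h; exfalso; move: h q3; move: #|F|; clear => q; nia.
by move=> _ ->; rewrite mul0r addr0.
Qed.

End Lines.

(** * Common zeros of the cubic and a form *)

Section Intersection.
Variables (F : fieldType) (k : nat -> F).
Hypothesis k0 : k 0%N != 0.
Local Notation R := {mpoly F[3]}.
Let S1 : pred 'I_3 := fun i => i != o0.

Lemma zform_shift S d s (H : R) : zform S d s H -> zform S d.+1 s.+1 H.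
Proof. by rewrite /zform ltnS subSS. Qed.

Lemma cubm_monic : exists c0 c1 c2 : R, [/\ is_form S1 3 c0, is_form S1 2 c1,
  is_form S1 1 c2 & cubm k = (k 0%N)%:MP * ('X_o0 ^+ 3 + c2 * 'X_o0 ^+ 2 + c1 * 'X_o0 + c0)].
Proof.
have f1 : is_form S1 1 ('X_o1 : R) by apply: form_var.
have f2 : is_form S1 1 ('X_o2 : R) by apply: form_var.
have fm2 (H K : R) c : is_form S1 1 H -> is_form S1 1 K -> is_form S1 2 (c%:MP * (H * K)).
  by move=> fH fK; apply: form_scale; apply: form_mul fH fK.
have fm3 (H K M : R) c : is_form S1 1 H -> is_form S1 1 K -> is_form S1 1 M ->
    is_form S1 3 (c%:MP * (H * K * M)).
  move=> fH fK fM; apply: form_scale.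
  exact: (form_mul (form_mul fH fK) fM).
pose c j := k j / k 0%N.
have cE j : (k j)%:MP = (k 0%N)%:MP * (c j)%:MP :> R.
  by rewrite -mpolyCM /c mulrCA divff // mulr1.
exists ((c 6)%:MP * ('X_o1 * 'X_o1 * 'X_o1) + (c 7)%:MP * ('X_o1 * 'X_o1 * 'X_o2)
   + (c 8)%:MP * ('X_o1 * 'X_o2 * 'X_o2) + (c 9)%:MP * ('X_o2 * 'X_o2 * 'X_o2)).
exists ((c 3)%:MP * ('X_o1 * 'X_o1) + (c 4)%:MP * ('X_o1 * 'X_o2)
   + (c 5)%:MP * ('X_o2 * 'X_o2)).
exists ((c 1%N)%:MP * 'X_o1 + (c 2)%:MP * 'X_o2).
split.
- by do 3?apply: form_D; apply: fm3.
- by do 2?apply: form_D; apply: fm2.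
- by apply: form_D; apply: form_scale.
rewrite /cubm /cub /kC /Xv (cE 1%N) (cE 2) (cE 3) (cE 4) (cE 5) (cE 6) (cE 7).
rewrite (cE 8) (cE 9).
ring.
Qed.

(** Division by the cubic as a polynomial in X with constant leading coefficient [k 0]; homogeneity
    makes the remainder's coefficients forms in Y, Z of degrees d, d - 1, d - 2. *)
Lemma monic_reduction d H : is_form predT d H -> exists A w0 w1 w2,
  [/\ zform S1 d 0 w0, zform S1 d 1 w1, zform S1 d 2 w2 &
      H = A * cubm k + w0 + w1 * 'X_o0 + w2 * 'X_o0 ^+ 2].
Proof.
have [c0 [c1 [c2 [fc0 fc1 fc2 kE]]]] := cubm_monic.
elim=> {d H} [d|c|d H K _ [A [w0 [w1 [w2 [z0 z1 z2 ->]]]]]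
    _ [A' [w0' [w1' [w2' [z0' z1' z2' ->]]]]]|d i H _ _ [A [w0 [w1 [w2 [z0 z1 z2 ->]]]]]].
- exists 0, 0, 0, 0; split; try exact: zform0; by ring.
- exists 0, c%:MP, 0, 0; split; try exact: zform0; last by ring.
  exact: form_C.
- exists (A + A'), (w0 + w0'), (w1 + w1'), (w2 + w2').
  split; try exact: zformD; by ring.
have [i0|i0] := eqVneq i o0.
  pose g : R := ((k 0%N)^-1)%:MP.
  have gk : g * (k 0%N)%:MP = 1 by rewrite -mpolyCM mulVf // mpolyC1.
  exists ('X_i * A + w2 * g), (- (w2 * c0)), (w0 - w2 * c1), (w1 - w2 * c2); split.
  + rewrite -sub0r; apply: zform_diff; first exact: zform0.
    apply: (@zformM _ _ d 2 3) => //; clear; lia.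
  + apply: zform_diff; first exact: zform_shift.
    apply: (@zformM _ _ d 2 2) => //; clear; lia.
  + apply: zform_diff; first exact: zform_shift.
    apply: (@zformM _ _ d 2 1) => //; clear; lia.
  rewrite i0; transitivity ('X_o0 * A * cubm k + w0 * 'X_o0 + w1 * 'X_o0 ^+ 2
    + w2 * 'X_o0 ^+ 3).
    by ring.
  transitivity ('X_o0 * A * cubm k + w2 * (g * (k 0%N)%:MP) *
     ('X_o0 ^+ 3 + c2 * 'X_o0 ^+ 2 + c1 * 'X_o0 + c0)
    - w2 * c0 + (w0 - w2 * c1) * 'X_o0 + (w1 - w2 * c2) * 'X_o0 ^+ 2).
    by rewrite gk; ring.
  by rewrite kE; ring.
exists ('X_i * A), (w0 * 'X_i), (w1 * 'X_i), (w2 * 'X_i); split; last by ring.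
- apply: (@zformM _ _ d 0 1) => //; last exact: form_var; clear; lia.
- apply: (@zformM _ _ d 1 1) => //; last exact: form_var; clear; lia.
- apply: (@zformM _ _ d 2 1) => //; last exact: form_var; clear; lia.
Qed.

Variables (L : closedFieldType) (f : {rmorphism F -> L}).
Local Notation kL := (f \o k).

Lemma binary_form_root n H : (0 < n)%N -> is_form S1 n H ->
  exists y z, ~ (y = 0 /\ z = 0) /\ forall x, ev f (vec3 x y z) H = 0.
Proof.
move=> n0 fH.
have {fH} [p [sp pE]] : exists p : {poly L}, (size p <= n.+1)%N /\ forall v,
    ev f v H = \sum_(i < n.+1) p`_i * v o1 ^+ i * v o2 ^+ (n - i).
  elim: fH => {n n0 H} [n|c|n H K _ [p [sp pE]] _ [p' [sp' pE']]|n i H Si _ [p [sp pE]]].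
  - exists 0; rewrite size_poly0; split=> // v; rewrite rmorph0 big1 // => i _.
    by rewrite coef0 !mul0r.
  - exists (f c)%:P; split; first exact: size_polyC_leq1.
    by move=> v; rewrite evC big_ord_recl big_ord0 coefC /= !mulr1 addr0.
  - exists (p + p'); split; first by rewrite (leq_trans (size_polyD _ _)) // geq_max sp sp'.
    move=> v; rewrite rmorphD pE pE' -big_split; apply: eq_bigr => i _.
    by rewrite coefD !mulrDl.
  move: i Si; apply: ord3P => // _.
  - exists (p * 'X); split.
      by apply: (leq_trans (size_polyMleq _ _)); rewrite size_polyX addn2.
    move=> v; rewrite rmorphM evX pE [RHS]big_ord_recl coefMX /= !mul0r add0r big_distrr /=.
    by apply: eq_bigr => i _; rewrite coefMX /= subSS exprS; ring.
  - exists p; split; first exact: leqW.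
    move=> v; rewrite rmorphM evX pE [RHS]big_ord_recr /= nth_default // !mul0r addr0.
    rewrite big_distrr /=; apply: eq_bigr => i _.
    have -> : (n.+1 - i = (n - i).+1)%N by rewrite subSn // -ltnS.
    by rewrite [v o2 ^+ _.+1]exprS; ring.
(* If the coefficient of Y^n vanishes, (1 : 0) is a zero; otherwise p has degree n and a root. *)
have [pn|pn] := eqVneq p`_n 0.
  exists 1, 0; split; first by case=> /eqP; rewrite oner_eq0.
  move=> x; rewrite pE big_ord_recr /= pn !mul0r addr0 big1 // => i _.
  by rewrite /vec3 /= expr0n subn_eq0 leqNgt ltn_ord /= mulr0.
have sp' : size p = n.+1.
  apply/eqP; rewrite eqn_leq sp /= leqNgt; apply: contra pn => h.
  by rewrite nth_default.
have /closed_rootP [y /rootP py] : size p != 1 by rewrite sp' eqSS -lt0n.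
exists y, 1; split; first by case=> _ /eqP; rewrite oner_eq0.
move=> x; rewrite pE -[RHS]py horner_coef sp'; apply: eq_bigr => i _.
by rewrite /vec3 /= expr1n mulr1.
Qed.

Lemma form_cast S d d' (H : R) : d = d' -> is_form S d H -> is_form S d' H.
Proof. by move=> ->. Qed.

(** The product of w0 + w1 x + w2 x^2 over the roots x of a monic cubic, expressed in their
    elementary symmetric functions, which are forms in Y and Z although the roots need not be. *)
Definition cubic_norm (R' : comNzRingType) (w0 w1 w2 e1 e2 e3 : R') : R' :=
  w0 ^+ 3 + w0 ^+ 2 * w1 * e1 + w0 ^+ 2 * w2 * (e1 ^+ 2 - e2 *+ 2)
  + w0 * w1 ^+ 2 * e2 + w0 * w1 * w2 * (e1 * e2 - e3 *+ 3)
  + w0 * w2 ^+ 2 * (e2 ^+ 2 - e1 * e3 *+ 2) + w1 ^+ 3 * e3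
  + w1 ^+ 2 * w2 * (e1 * e3) + w1 * w2 ^+ 2 * (e2 * e3) + w2 ^+ 3 * e3 ^+ 2.

Lemma cubic_normE (R' : comNzRingType) (w0 w1 w2 x y z : R') :
  cubic_norm w0 w1 w2 (x + y + z) (x * y + x * z + y * z) (x * y * z) =
  (w0 + w1 * x + w2 * x ^+ 2) * (w0 + w1 * y + w2 * y ^+ 2)
  * (w0 + w1 * z + w2 * z ^+ 2).
Proof. by rewrite /cubic_norm; ring. Qed.

Lemma cubic_norm_form d (w0 w1 w2 e1 e2 e3 : R) :
  is_form S1 d.+2 w0 -> is_form S1 d.+1 w1 -> is_form S1 d w2 ->
  is_form S1 1 e1 -> is_form S1 2 e2 -> is_form S1 3 e3 ->
  is_form S1 (d.+2 * 3) (cubic_norm w0 w1 w2 e1 e2 e3).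
Proof.
move=> f0 f1 f2 g1 g2 g3.
have fMn S n m (H : R) : is_form S n H -> is_form S n (H *+ m).
  move=> fH; elim: m => [|m IHm]; first by rewrite mulr0n; apply: form_0.
  by rewrite mulrS; apply: form_D.
have h2 (H : R) a : is_form S1 a H -> is_form S1 (a + a) (H ^+ 2).
  by move=> fH; rewrite expr2; apply: form_mul.
have h3 (H : R) a : is_form S1 a H -> is_form S1 (a + (a + a)) (H ^+ 3).
  by move=> fH; rewrite exprS; apply: form_mul => //; apply: h2.
rewrite /cubic_norm; do 9?apply: form_D.
- apply: form_cast (h3 _ _ f0); clear; lia.
- apply: form_cast (form_mul (form_mul (h2 _ _ f0) f1) g1); clear; lia.
- apply: form_cast (form_mul (form_mul (h2 _ _ f0) f2)
    (form_diff (h2 _ _ g1) (fMn _ _ 2 _ g2))).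
  clear; lia.
- apply: form_cast (form_mul (form_mul f0 (h2 _ _ f1)) g2); clear; lia.
- apply: form_cast (form_mul (form_mul (form_mul f0 f1) f2)
    (form_diff (form_mul g1 g2) (fMn _ _ 3 _ g3))); clear; lia.
- apply: form_cast (form_mul (form_mul f0 (h2 _ _ f2))
    (form_diff (h2 _ _ g2) (fMn _ _ 2 _ (form_mul g1 g3)))); clear; lia.
- apply: form_cast (form_mul (h3 _ _ f1) g3); clear; lia.
- apply: form_cast (form_mul (form_mul (h2 _ _ f1) f2) (form_mul g1 g3)); clear; lia.
- apply: form_cast (form_mul (form_mul f1 (h2 _ _ f2)) (form_mul g2 g3)); clear; lia.
- apply: form_cast (form_mul (h3 _ _ f2) (h2 _ _ g3)); clear; lia.
Qed.

(* Bezout: the norm of [H] modulo the cubic is a binary form, hence has a zero. *)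
Lemma intersection d H : (1 < d)%N -> is_form predT d H ->
  exists v : 'I_3 -> L, [/\ ~ v =1 (fun=> 0), cub kL v = 0 & ev f v H = 0].
Proof.
move=> d2 fH.
have [c0 [c1 [c2 [fc0 fc1 fc2 kE]]]] := cubm_monic.
have [A [w0 [w1 [w2 [z0 z1 z2 HE]]]]] := monic_reduction fH.
case: d d2 fH z0 z1 z2 => [|[|d]] // _ _; rewrite /zform /= !subSS !subn0 => fw0 fw1 fw2.
have fN n (K : R) : is_form S1 n K -> is_form S1 n (- K).
  by move=> fK; rewrite -sub0r; apply: form_diff => //; apply: form_0.
have fnorm := cubic_norm_form fw0 fw1 fw2 (fN _ _ fc2) fc1 (fN _ _ fc0).
have [//|y [z [yz Nyz]]] := binary_form_root _ fnorm.
have evS n K x : is_form S1 n K -> ev f (vec3 x y z) K = ev f (vec3 0 y z) K.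
  elim=> [?|c|? ? ? _ E1 _ E2|? i ? Si _ E]; first by rewrite !rmorph0.
  - by rewrite !evC.
  - by rewrite !rmorphD E1 E2.
  by rewrite !rmorphM E !evX; move: i Si; apply: ord3P.
set e := ev f (vec3 0 y z) in evS.
(* The cubic above the zero (y : z) of the norm; one of its roots is also a root of the remainder of
   H. *)
pose p : {poly L} := 'X^3 + (e c2) *: 'X^2 + (e c1) *: 'X + (e c0)%:P.
have sp : size p = 4.
  rewrite /p -!addrA size_polyDl size_polyXn //.
  rewrite (leq_ltn_trans (size_polyD _ _)) // gtn_max.
  rewrite (leq_ltn_trans (size_scale_leq _ _)) ?size_polyXn //=.
  rewrite (leq_ltn_trans (size_polyD _ _)) // gtn_max.
  rewrite (leq_ltn_trans (size_scale_leq _ _)) ?size_polyX //=.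
  by rewrite (leq_ltn_trans (size_polyC_leq1 _)).
have [rs prs] := closed_field_poly_normal p.
have lp : lead_coef p = 1.
  rewrite lead_coefE sp /p !coefD !coefZ !coefXn coefX coefC /=; ring.
rewrite lp scale1r in prs.
have srs : size rs = 3%N.
  by apply/eqP; rewrite -eqSS -[(size rs).+1](size_prod_XsubC rs id) -prs sp.
case: rs srs prs => [|x1 [|x2 [|x3 [|//]]]] // _.
rewrite !big_cons big_nil mulr1 => pE.
have {}pE : p = 'X^3 - (x1 + x2 + x3) *: 'X^2 + (x1 * x2 + x1 * x3 + x2 * x3) *: 'X
    - (x1 * x2 * x3)%:P.
  by rewrite pE -!mul_polyC !polyCD !polyCM; ring.
have h2 : - e c2 = x1 + x2 + x3.
  have := congr1 (fun r : {poly L} => - r`_2) pE.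
  rewrite /p !(coefD, coefN, coefZ, coefXn, coefX, coefC) /= => h.
  by transitivity (- (0 + e c2 * 1 + e c1 * 0 + 0)); [ring | rewrite h; ring].
have h1 : e c1 = x1 * x2 + x1 * x3 + x2 * x3.
  have := congr1 (fun r : {poly L} => r`_1) pE.
  rewrite /p !(coefD, coefN, coefZ, coefXn, coefX, coefC) /= => h.
  by transitivity (0 + e c2 * 0 + e c1 * 1 + 0); [ring | rewrite h; ring].
have h0 : - e c0 = x1 * x2 * x3.
  have := congr1 (fun r : {poly L} => - r`_0) pE.
  rewrite /p !(coefD, coefN, coefZ, coefXn, coefX, coefC) /= => h.
  by transitivity (- (0 + e c2 * 0 + e c1 * 0 + e c0)); [ring | rewrite h; ring].
have : cubic_norm (e w0) (e w1) (e w2) (- e c2) (e c1) (- e c0) = 0.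
  by rewrite -[RHS](Nyz 0) -/e /cubic_norm; ring.
rewrite h2 h1 h0 cubic_normE => N0.
have [x [px wx]] : exists x, x ^+ 3 + e c2 * x ^+ 2 + e c1 * x + e c0 = 0 /\
    e w0 + e w1 * x + e w2 * x ^+ 2 = 0.
  have px x : x ^+ 3 + e c2 * x ^+ 2 + e c1 * x + e c0 = (x - x1) * (x - x2) * (x - x3).
    by rewrite -[e c2]opprK -[e c0]opprK h2 h1 h0; ring.
  move/eqP: N0; rewrite !mulf_eq0 -orbA => /or3P [] /eqP Nx;
    [exists x1|exists x2|exists x3]; split=> //; rewrite px; ring.
have hk (h : {rmorphism R -> L}) : h (cubm k) = h (k 0%N)%:MP *
    (h 'X_o0 ^+ 3 + h c2 * h 'X_o0 ^+ 2 + h c1 * h 'X_o0 + h c0) by rewrite kE; ring.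
have hH (h : {rmorphism R -> L}) : h (A * cubm k + w0 + w1 * 'X_o0 + w2 * 'X_o0 ^+ 2) =
    h A * h (cubm k) + (h w0 + h w1 * h 'X_o0 + h w2 * h 'X_o0 ^+ 2) by ring.
exists (vec3 x y z); split.
- by move=> h; apply: yz; split; [exact: (h o1) | exact: (h o2)].
- rewrite -ev_cubm hk evX.
  by rewrite (evS _ _ _ fc2) (evS _ _ _ fc1) (evS _ _ _ fc0) px mulr0.
rewrite HE hH hk evX (evS _ _ _ fc2) (evS _ _ _ fc1) (evS _ _ _ fc0) px.
by rewrite (evS _ _ _ fw0) (evS _ _ _ fw1) (evS _ _ _ fw2) !mulr0 add0r.
Qed.

End Intersection.

(** * Producing the rational point *)

Section RationalPoint.
Variables (F : finFieldType) (k : nat -> F).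
Hypothesis smk : smooth_coef k.
Local Notation q := #|F|.

Lemma rational_point_of_card_gt2 : (2 < q)%N -> exists a, ~ a =1 (fun=> 0) /\ cub k a = 0.
Proof.
move=> q3.
suff [a [a0 ka]] : exists a : {ffun 'I_3 -> F}, ~ a =1 (fun=> 0) /\ cub k a = 0.
  by exists a.
have [/existsP [a /andP [/existsP [i ai] /eqP ka]]|no] :=
  boolP [exists a : {ffun 'I_3 -> F}, [exists i, a i != 0] && (cub k a == 0)].
  by exists a; split=> // h; rewrite h eqxx in ai.
have no_point a : cub k a = 0 -> a =1 fun=> 0.
  move=> ka; have [//|[i ai]] := vec3_eq0_or a; case/negP: no.
  apply/existsP; exists (finfun a); apply/andP; split.
    by apply/existsP; exists i; rewrite ffunE.
  by rewrite -[0]ka; apply/eqP; apply: eq_cub => // j; rewrite ffunE.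
have [L [f _]] := countable_algebraic_closure F; exfalso.
have [A GE] := tangency_divisible no_point f q3.
have k0 : k 0%N != 0.
  have := cub_neq0 no_point (a := vec3 1 0 0); rewrite /cub /vec3 /= => h.
  have {h} := h _; rewrite !(expr1n, expr0n, mulr0, mulr1, addr0) /=; apply.
  by move=> /(_ o0) /eqP; rewrite oner_eq0.
pose kL := f \o k.
(* The zeros of this form on the cubic are the points whose tangent line contains their Frobenius
   image. *)
have fW : is_form predT (2 * 1 + q) (pol (kC k) (@Xv F) (fr q (@Xv F))).
  by apply: pol_form => i; [apply: form_var | apply: form_pow1; apply: form_var].
have d2 : (1 < 2 * 1 + q)%N by move: q q3; clear => q; lia.
have [v [v0 kv Wv]] := intersection k0 f d2 fW.
have pvb : pol kL v (fr q v) = 0.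
  rewrite -Wv rmorph_pol; apply: eq_pol => i /=; rewrite ?rmorphXn ?evX //.
  exact: (esym (evC _ _ _)).
have ab := frob_indep no_point v0 kv.
have nsL : nonsing kL := @smooth_nonsing F L f k smk.
have kb : cub kL (fr q v) = 0 by apply: cub_frob_eq0.
have pbv := nonsing_no_line nsL ab kv kb pvb.
have pvc : pol kL v (fr (q ^ 2) v) = 0.
  have G0 : tangency kL q v = 0.
    by rewrite -ev_tangency GE rmorphM ev_cubm kv mulr0.
  apply/eqP; have /eqP := G0; rewrite /tangency.
  rewrite (@eq_pol _ kL kL _ (fun i => pol kL (fr q v) v * v i) _ (fr (q ^ 2) v)) //.
    by rewrite polZl mulf_eq0 expf_eq0 /= => /orP [/eqP|].
  by move=> i; rewrite /third_point pvb oppr0 mul0r addr0.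
(* The tangent line at [v] is spanned by [v] and b. On it the cubic is s t^2 times a non-zero
   constant, so c is proportional to [v] or to b. *)
have [||s [t E]] := @indep_span _ (grad kL v) v (fr q v) (fr (q ^ 2) v) _ _ pvb pvc ab.
- by move=> g0; apply: v0; apply: nsL.
- by rewrite -[LHS]/(pol kL v v) pol_diag kv mul0rn.
have kc : cub kL (fr (q ^ 2) v) = 0.
  rewrite -(eq_cub (frefl kL) (fr_fr q v)) cub_fr kb expr0n.
  by rewrite finField_card_eq0.
have /eqP : s * t ^+ 2 * pol kL (fr q v) v = 0.
  rewrite -[RHS]kc (eq_cub (frefl kL) E) cub_comb kv kb pvb; ring.
rewrite mulf_eq0 mulf_eq0 expf_eq0 /= => /orP [/orP [/eqP s0|/eqP t0]|/eqP //].
  apply: (fr2_not_fr no_point v0 kv (s := t)) => i.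
  by rewrite E s0 mul0r add0r.
have Ec i : fr (q ^ 2) v i = s * v i by rewrite E t0 mul0r addr0.
(* With c = s v the left side is pol(b, c), the q-th power of pol(v, b) = 0. *)
have : s * pol kL (fr q v) v = 0.
  rewrite -polZr; transitivity (pol kL (fr q v) (fr q (fr q v))).
    by apply: eq_pol => // i; rewrite fr_fr Ec.
  by rewrite pol_fr pvb expr0n finField_card_eq0.
move/eqP; rewrite mulf_eq0 => /orP [/eqP s0|/eqP //].
apply: (fr2_not_fr no_point v0 kv (s := 0)) => i.
by rewrite Ec s0 !mul0r.
Qed.

End RationalPoint.

(* Over [F_2] a cubic form without nontrivial zero takes the value 1 everywhere; there
   are eight of them, the norm forms of [F_8], singular at the points below. *)
Lemma rational_point_F2 (F : finFieldType) (k : nat -> F) : smooth_coef k ->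
  #|F| = 2%N -> exists a, ~ a =1 (fun=> 0) /\ cub k a = 0.
Proof.
move=> smk q2.
have two : 2 = 0 :> F by rewrite -q2 finField_card0.
have b01 (x : F) : x = 0 \/ x = 1.
  have [->|x0] := eqVneq x 0; first by left.
  by right; apply: (mulfI x0); rewrite mulr1 -expr2 -q2 expf_card.
pose pt b0 b1 b2 : 'I_3 -> F := vec3 b0 b1 b2.
have one0 : (1 : F) <> 0 by apply/eqP/oner_neq0.
have pt0 b0 b1 b2 : [\/ b0 = 1, b1 = 1 | b2 = 1] -> ~ pt b0 b1 b2 =1 (fun=> 0).
  by case=> ->; move=> h; apply: one0; [exact: (h o0)|exact: (h o1)|exact: (h o2)].
have key b0 b1 b2 : [\/ b0 = 1, b1 = 1 | b2 = 1] ->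
    (exists a, ~ a =1 (fun=> 0) /\ cub k a = 0) \/ cub k (pt b0 b1 b2) = 1.
  move=> hb; have [k0|] := b01 (cub k (pt b0 b1 b2)); last by right.
  by left; exists (pt b0 b1 b2); split=> //; apply: pt0.
have [//|k0] := key 1 0 0 (Or31 _ _ erefl).
have [//|k6] := key 0 1 0 (Or32 _ _ erefl).
have [//|k9] := key 0 0 1 (Or33 _ _ erefl).
have [//|k13] := key 1 1 0 (Or31 _ _ erefl).
have [//|k25] := key 1 0 1 (Or31 _ _ erefl).
have [//|k78] := key 0 1 1 (Or32 _ _ erefl).
have [//|k4] := key 1 1 1 (Or31 _ _ erefl).
exfalso; move: k0 k6 k9 k13 k25 k78 k4; rewrite /pt /cub /vec3 /=.
rewrite !(expr1n, expr0n, mulr0, mul0r, mulr1, addr0, add0r) /= => k0 k6 k9.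
rewrite k0 k6 k9 => k13 k25 k78 k4.
(* Solves x = 1 for one unknown z modulo 2; [c] collects the even part. *)
have lin (x y z c : F) : x = 1 -> z - y - 2 * c = x - 1 -> z = y.
  by move=> ->; rewrite subrr two mul0r subr0 => /subr0_eq.
have k3 : k 3 = 1 - k 1%N by apply: (lin _ _ _ (-1) k13); ring.
have k5 : k 5 = 1 - k 2 by apply: (lin _ _ _ (-1) k25); ring.
have k8 : k 8 = 1 - k 7 by apply: (lin _ _ _ (-1) k78); ring.
have k4' : k 4 = 1 by move: k4; rewrite k3 k5 k8 => k4; apply: (lin _ _ _ (-3) k4); ring.
have [L [f _]] := countable_algebraic_closure F.
have t2 : 2 = 0 :> L by rewrite -(rmorph_nat f) two rmorph0.
(* [t] generates F_8, where the singular points below have their coordinates. *)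
have [t t3] : exists t : L, t ^+ 3 = t + 1.
  pose p : {poly L} := Poly [:: -1; -1; 0; 1].
  have sp : size p = 4 by rewrite (@PolyK _ 0) //= oner_neq0.
  have /closed_rootP [t /rootP pt0'] : size p != 1 by rewrite sp.
  exists t; apply/eqP; rewrite -subr_eq0 -[X in _ == X]pt0' horner_coef sp.
  by rewrite !big_ord_recl big_ord0 !coef_Poly /=; apply/eqP; ring.
have sing (y z c0 c1 c2 : L) : grad (f \o k) (vec3 1 y z) o0 = 2 * c0 ->
    grad (f \o k) (vec3 1 y z) o1 = 2 * c1 -> grad (f \o k) (vec3 1 y z) o2 = 2 * c2 ->
    False.
  rewrite t2 !mul0r => g0 g1 g2.
  have g : grad (f \o k) (vec3 1 y z) =1 fun=> 0 by apply: eq0_vec3.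
  have c : cub (f \o k) (vec3 1 y z) = 0.
    (* Euler's relation gives 3 cub = 0, which suffices because 3 = 1. *)
    have := pol_diag (f \o k) (vec3 1 y z); rewrite /pol /dot !g !mul0r !addr0 => h.
    transitivity (cub (f \o k) (vec3 1 y z) *+ 3 - 2 * cub (f \o k) (vec3 1 y z)).
      by ring.
    by rewrite -h t2 mul0r subr0.
  have /(_ o0) /eqP := smk L f (vec3 1 y z) c g.
  by rewrite /vec3 /= oner_eq0.
case: (b01 (k 1%N)) => k1; case: (b01 (k 2)) => k2; case: (b01 (k 7)) => k7.
(* The last three arguments are half the partial derivatives, whose integer coefficients are even
   after reduction by t^3 = t + 1. *)
- apply: (sing (t ^+ 2) (t) (2 + 1 * t + 1 * t ^+ 2)
    (0 + 2 * t + 3 * t ^+ 2) (1 + 2 * t + 2 * t ^+ 2));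
  rewrite /grad /vec3 /= !(k0, k6, k9, k4', k3, k5, k8, k1, k2, k7); ring: t3.
- apply: (sing (t) (t ^+ 2) (2 + 1 * t + 1 * t ^+ 2)
    (1 + 2 * t + 2 * t ^+ 2) (0 + 2 * t + 3 * t ^+ 2));
  rewrite /grad /vec3 /= !(k0, k6, k9, k4', k3, k5, k8, k1, k2, k7); ring: t3.
- apply: (sing (t ^+ 2) (1 + t) (3 + 2 * t + 1 * t ^+ 2)
    (1 + 3 * t + 3 * t ^+ 2) (3 + 4 * t + 3 * t ^+ 2));
  rewrite /grad /vec3 /= !(k0, k6, k9, k4', k3, k5, k8, k1, k2, k7); ring: t3.
- apply: (sing (1 + t) (1 + t ^+ 2) (4 + 2 * t + 2 * t ^+ 2)
    (5 + 6 * t + 3 * t ^+ 2) (3 + 3 * t + 5 * t ^+ 2));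
  rewrite /grad /vec3 /= !(k0, k6, k9, k4', k3, k5, k8, k1, k2, k7); ring: t3.
- apply: (sing (1 + t ^+ 2) (1 + t) (4 + 2 * t + 2 * t ^+ 2)
    (3 + 3 * t + 5 * t ^+ 2) (5 + 6 * t + 3 * t ^+ 2));
  rewrite /grad /vec3 /= !(k0, k6, k9, k4', k3, k5, k8, k1, k2, k7); ring: t3.
- apply: (sing (1 + t) (t ^+ 2) (3 + 2 * t + 1 * t ^+ 2)
    (3 + 4 * t + 3 * t ^+ 2) (1 + 3 * t + 3 * t ^+ 2));
  rewrite /grad /vec3 /= !(k0, k6, k9, k4', k3, k5, k8, k1, k2, k7); ring: t3.
- apply: (sing (1 + t ^+ 2) (t) (3 + 2 * t + 1 * t ^+ 2)
    (2 + 2 * t + 5 * t ^+ 2) (2 + 2 * t + 2 * t ^+ 2));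
  rewrite /grad /vec3 /= !(k0, k6, k9, k4', k3, k5, k8, k1, k2, k7); ring: t3.
- apply: (sing (t) (1 + t ^+ 2) (3 + 2 * t + 1 * t ^+ 2)
    (2 + 2 * t + 2 * t ^+ 2) (2 + 2 * t + 5 * t ^+ 2));
  rewrite /grad /vec3 /= !(k0, k6, k9, k4', k3, k5, k8, k1, k2, k7); ring: t3.
Qed.

Lemma rational_point (F : finFieldType) (k : nat -> F) : smooth_coef k ->
  exists a, ~ a =1 (fun=> 0) /\ cub k a = 0.
Proof.
move=> smk; have := finNzRing_gt1 F; rewrite leq_eqVlt => /orP [/eqP q2|q2].
  exact: rational_point_F2.
exact: rational_point_of_card_gt2.
Qed.

(** * Representability over large and small fields *)

Lemma no_flex_form_of_card_gt4 (F : finFieldType) (k : nat -> F) : (4 < #|F|)%N ->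
  ~ flex_form k.
Proof.
move=> q4; have [two|two] := eqVneq (2 : F) 0; first exact: even_no_flex_form.
exact: odd_no_flex_form.
Qed.

Lemma unique_nonldr_classP (F : finFieldType) (k : nat -> F) :
  smooth_coef k -> flex_form k ->
  (forall k', flex_form k' -> proj_equiv (cubm k') (cubm k)) ->
  unique_nonldr_class (cubm k).
Proof.
move=> smk fk uk; split; first exact: smooth_cubm.
split; first exact: no_ldr_of_no_affine_point.
move=> P /smooth_cubicP [k' -> smk'] nl.
have [a [a0 ka]] := rational_point smk'.
have [//|[k'' fk'' e]] := ldr_or_flex_form smk' a0 ka.
exact: proj_equiv_trans e (uk _ fk'').
Qed.

Theorem theorem6p1 (F : finFieldType) :
  ((4 < #|F|)%N ->
     forall P : {mpoly F[3]}, smooth_cubic P -> has_ldr P)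
  /\ (#|F| = 2%N -> unique_nonldr_class (cubic_q2 F))
  /\ (#|F| = 3%N -> unique_nonldr_class (cubic_q3 F))
  /\ (#|F| = 4%N -> forall w : F, w ^+ 2 + w + 1 = 0 ->
                      unique_nonldr_class (cubic_q4 w)).
Proof.
split.
  move=> q4 P /smooth_cubicP [k -> smk].
  have [a [a0 ka]] := rational_point smk.
  have [//|[k' fk' _]] := ldr_or_flex_form smk a0 ka.
  by case: (no_flex_form_of_card_gt4 q4 fk').
split; first move=> q2.
  have two : 2 = 0 :> F by rewrite -q2 finField_card0.
  rewrite cubic_q2E; apply: unique_nonldr_classP.
  - exact: smooth_coef2.
  - exact: flex_form_coef2.
  - by move=> k'; apply: flex_form2_unique.
split; first move=> q3.
  have three : 3 = 0 :> F by rewrite -q3 finField_card0.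
  rewrite cubic_q3E; apply: unique_nonldr_classP.
  - exact: smooth_coef3.
  - exact: flex_form_coef3.
  - by move=> k'; apply: flex_form3_unique.
move=> q4 w hw.
have two : 2 = 0 :> F.
  have := finField_card0 F; rewrite q4 (natrM _ 2 2) => /eqP.
  by rewrite mulf_eq0 orbb => /eqP.
rewrite cubic_q4E; apply: unique_nonldr_classP.
- exact: smooth_coef4.
- exact: flex_form_coef4.
- by move=> k'; apply: flex_form4_unique.
Qed.
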